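(* Fix $\mu>0$. Then $\mathcal L(\cdot,\mu)$ is coercive on $\mathcal S$ in the sense that $\lim_{X\to\partial\mathcal S}\mathcal L(X,\mu)=+\infty$, where $\partial\mathcal S$ denotes the boundary of $\mathcal S$, and for every $\alpha$ the $\alpha$-sublevel set $\mathcal S_\alpha=\{X\in\mathcal S:\mathcal L(X,\mu)\le\alpha\}$ is compact.
   Context: Setting. $x_{t+1}=Ax_t+Bu_t+w_t$ with $x_t\in\mathbb R^n$, $u_t\in\mathbb R^m$; $\{w_t\}$ is an i.i.d. sequence with finite fourth moments, mean $\bar w=\mathbb E[w_t]$ and covariance $W=\mathbb E[(w_t-\bar w)(w_t-\bar w)^\top]>0$ (positive definite). $Q$ is positive semi-definite, $R$ is positive definite, $(A,B)$ is controllable and $(A,Q^{1/2})$ is observable. Let $M_3=\mathbb E[(w_t-\bar w)(w_t-\bar w)^\top Q(w_t-\bar w)]$ and let $\bar\rho\in\mathbb R$ be a given constant. A policy is $X=[K,l]$ with $K\in\mathbb R^{m\times n}$, $l\in\mathbb R^m$, meaning $u_t=-Kx_t+l$. $\mathcal S=\{[K,l]:\rho(A-BK)<1\}$ ($\rho(\cdot)$ = spectral radius). For $\mu\ge0$ let $Q_\mu=Q+4\mu QWQ$, $S=2\mu QM_3\in\mathbb R^n$, $c_\mu(x,u)=x^\top Q_\mu x+2x^\top S+u^\top Ru-\mu\bar\rho$. For $X\in\mathcal S$ the Lagrangian is $$\mathcal L(X,\mu)=\lim_{T\to\infty}\tfrac1T\mathbb E\Big[\sum_{t=0}^{T-1}c_\mu(x_t,u_t)\Big],\quad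 u_t=-Kx_t+l.$$ *)

(* Defs.v *)
From HB Require Import structures.
From mathcomp Require Import all_boot all_order all_algebra.
From mathcomp Require Import all_classical all_reals all_analysis.
From mathcomp Require Import complex.

Set Implicit Arguments.
Unset Strict Implicit.
Unset Printing Implicit Defensive.

Import Order.TTheory GRing.Theory Num.Theory.
Import numFieldNormedType.Exports.

Local Open Scope classical_set_scope.
Local Open Scope ring_scope.

Section LinearAlgebra.
Variable R : realType.

Definition dotv (n : nat) (x y : 'cV[R]_n) : R := (x^T *m y) 0 0.

Definition quad (n : nat) (M : 'M[R]_n) (x : 'cV[R]_n) : R :=
  (x^T *m M *m x) 0 0.

(* Semi-definiteness and definiteness include symmetry. *)
Definition psd (n : nat) (M : 'M[R]_n) : Prop :=
  M^T = M /\ forall x : 'cV[R]_n, 0 <= quad M x.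

Definition posdef (n : nat) (M : 'M[R]_n) : Prop :=
  M^T = M /\ forall x : 'cV[R]_n, x != 0 -> 0 < quad M x.

(* N is the principal square root Q^{1/2}: such an N exists and is unique as
   soon as Q is positive semi-definite. *)
Definition is_psd_sqrt (n : nat) (Q N : 'M[R]_n) : Prop :=
  psd N /\ N *m N = Q.

(* [B, AB, ..., A^(n-1) B] has full row rank. *)
Definition controllable (n m : nat) (A : 'M[R]_n) (B : 'M[R]_(n, m)) : Prop :=
  \rank (\mxrow_(i < n) (A ^+ i *m B)) = n.

Definition observable (n p : nat) (A : 'M[R]_n) (C : 'M[R]_(p, n)) : Prop :=
  \rank (\mxcol_(i < n) (C *m A ^+ i)) = n.

(* The eigenvalues are the complex ones; the supremum is 0 when n = 0. *)
Definition spectral_radius (n : nat) (F : 'M[R]_n) : R :=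
  sup [set ComplexField.Normc.normc z | z in
        [set z : R[i] | eigenvalue (map_mx (real_complex R) F) z]].

End LinearAlgebra.

Section RandomVectors.
Context d (Omega : measurableType d) (R : realType).
Variable P : probability Omega R.

Definition borel (n : nat) : set_system 'cV[R]_n :=
  <<s @open 'cV[R]_n >>.

(* All the entries of X have a finite moment of order p (and are measurable). *)
Definition finite_moment (p : nat) (n : nat) (X : Omega -> 'cV[R]_n) : Prop :=
  forall i, (fun o => X o i 0) \in Lfun P (p%:R)%:E.

Definition iid (n : nat) (w : nat -> Omega -> 'cV[R]_n) : Prop :=
  [/\ forall t E, borel E -> measurable (w t @^-1` E),
      forall (s : seq nat) (E : nat -> set 'cV[R]_n), uniq s ->
        (forall t, borel (E t)) ->
        P (\big[setI/setT]_(t <- s) (w t @^-1` E t)) =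
        (\prod_(t <- s) P (w t @^-1` E t))%E
    & forall t E, borel E -> P (w t @^-1` E) = P (w 0%N @^-1` E)].

Definition Emx (p q : nat) (X : Omega -> 'M[R]_(p, q)) : 'M[R]_(p, q) :=
  \matrix_(i, j) fine ('E_P[fun o => X o i j]).

Variables (n : nat) (w : Omega -> 'cV[R]_n).

Definition centered (o : Omega) : 'cV[R]_n := w o - Emx w.

Definition covmx : 'M[R]_n := Emx (fun o => centered o *m (centered o)^T).

Definition third_moment (Q : 'M[R]_n) : 'cV[R]_n :=
  Emx (fun o => centered o *m (centered o)^T *m Q *m centered o).

End RandomVectors.

Section LQR.
Variable R : realType.
Variables n m : nat.

(* A policy X = [K, l] is an m x (n + 1) matrix, with the usual topology. *)
Definition gain (X : 'M[R]_(m, n + 1)) : 'M[R]_(m, n) := lsubmx X.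
Definition offset (X : 'M[R]_(m, n + 1)) : 'cV[R]_m := rsubmx X.

Variables (A : 'M[R]_n) (B : 'M[R]_(n, m)).

Definition stabilizing : set 'M[R]_(m, n + 1) :=
  [set X | spectral_radius (A - B *m gain X) < 1].

Definition control (X : 'M[R]_(m, n + 1)) (x : 'cV[R]_n) : 'cV[R]_m :=
  - (gain X *m x) + offset X.

Context d (Omega : measurableType d).
Variable P : probability Omega R.
Variables (w : nat -> Omega -> 'cV[R]_n) (x0 : Omega -> 'cV[R]_n).

Fixpoint state (X : 'M[R]_(m, n + 1)) (t : nat) (o : Omega) : 'cV[R]_n :=
  if t is t'.+1 then
    A *m state X t' o + B *m control X (state X t' o) + w t' o
  else x0 o.

Variables (Q : 'M[R]_n) (Ru : 'M[R]_m) (rhobar mu : R).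

(* The noise is identically distributed, so its moments are read off w_0. *)
Definition Qmu : 'M[R]_n := Q + (4 * mu) *: (Q *m covmx P (w 0%N) *m Q).

Definition Smu : 'cV[R]_n := (2 * mu) *: (Q *m third_moment P (w 0%N) Q).

Definition cost (x : 'cV[R]_n) (u : 'cV[R]_m) : R :=
  quad Qmu x + 2 * dotv x Smu + quad Ru u - mu * rhobar.

Definition lagrangian (X : 'M[R]_(m, n + 1)) : \bar R :=
  limn (fun T : nat => (T%:R^-1)%:E *
    'E_P[fun o => (\sum_(0 <= t < T)
           cost (state X t o) (control X (state X t o)))%R])%E.

End LQR.

Section Boundary.
Variables (R : realType) (T : pseudoMetricType R).

Definition boundary (S : set T) : set T := closure S `\` interior S.

(* The filter of the points of S whose distance to the boundary tends to 0. *)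
Definition to_boundary (S : set T) : set_system T :=
  [set U | exists2 e : R, 0 < e &
     forall x y, S x -> boundary S y -> ball y e x -> U x].

End Boundary.

(* Main.v *)
(* In the stationary regime of a stabilizing policy X = [K, l], with
   F = A - B K, the Lagrangian splits as

     L(X) = h(X) + sum_k g_k(X),
     g_k(X) = tr((Q_mu + K^T R K) F^k W (F^k)^T) >= 0,

   where h(X) is the cost at the stationary mean.  Completing the square in
   2 x^T S, where S lies in the range of Q, bounds h below by a constant plus
   multiples of |Q^(1/2) x|^2 and |u|^2.  On a sublevel set g_0 therefore bounds
   K (as W and R are positive definite) and, by observability, h bounds the
   stationary mean, hence l.  At a limit point of a sublevel set the partial sums
   of g_k remain bounded, so Q^(1/2) F^k and K F^k tend to 0; observability gives
   F^k -> 0, and the limit point is still stabilizing.  Sublevel sets are thus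
   compact.  The set of stabilizing policies is open, so a compact subset of it
   stays at positive distance from the boundary, and the blow-up follows. *)

Require Import Defs.
From HB Require Import structures.
From mathcomp Require Import all_boot all_order all_algebra.
From mathcomp Require Import all_classical all_reals all_analysis.
From mathcomp Require Import complex measurable_realfun ring lra.

Set Implicit Arguments.
Unset Strict Implicit.
Unset Printing Implicit Defensive.

Import Order.TTheory GRing.Theory Num.Theory.
Import numFieldNormedType.Exports.
Local Open Scope classical_set_scope.
Local Open Scope ring_scope.

(** * The entrywise l1 norm *)

Section EntrywiseNorm.
Variable K : numDomainType.

Definition nrm (m n : nat) (M : 'M[K]_(m, n)) : K := \sum_i \sum_j `|M i j|.

Lemma nrm_ge0 m n (M : 'M[K]_(m, n)) : 0 <= nrm M.
Proof. by do 2!apply: sumr_ge0 => ? _. Qed.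

Lemma le_nrm m n (M : 'M[K]_(m, n)) i j : `|M i j| <= nrm M.
Proof.
rewrite /nrm (bigD1 i)//= (bigD1 j)//= -addrA lerDl addr_ge0//.
  exact: sumr_ge0.
by apply: sumr_ge0 => ? _; apply: sumr_ge0.
Qed.

Lemma nrmD m n (M N : 'M[K]_(m, n)) : nrm (M + N) <= nrm M + nrm N.
Proof.
rewrite /nrm -big_split/=; apply: ler_sum => i _.
by rewrite -big_split/=; apply: ler_sum => j _; rewrite mxE ler_normD.
Qed.

Lemma nrmM m n p (M : 'M[K]_(m, n)) (N : 'M[K]_(n, p)) :
  nrm (M *m N) <= nrm M * nrm N.
Proof.
rewrite {1 2}/nrm mulr_suml; apply: ler_sum => i _.
rewrite mulr_suml.
apply: (@le_trans _ _ (\sum_j \sum_k `|M i k| * `|N k j|)).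
  apply: ler_sum => j _; rewrite mxE (le_trans (ler_norm_sum _ _ _))//.
  by apply: ler_sum => k _; rewrite normrM.
rewrite exchange_big/=; apply: ler_sum => k _; rewrite -mulr_sumr.
rewrite ler_wpM2l// /nrm (bigD1 k)//= lerDl.
by do 2!apply: sumr_ge0 => ? _.
Qed.

Lemma nrmT m n (M : 'M[K]_(m, n)) : nrm M^T = nrm M.
Proof.
rewrite /nrm exchange_big/=; apply: eq_bigr => i _.
by apply: eq_bigr => j _; rewrite mxE.
Qed.

Lemma nrm0 m n : nrm (0 : 'M[K]_(m, n)) = 0.
Proof. by rewrite /nrm big1// => i _; rewrite big1// => j _; rewrite mxE normr0. Qed.

Lemma nrm_sum m n (I : Type) (r : seq I) (F : I -> 'M[K]_(m, n)) :
  nrm (\sum_(i <- r) F i) <= \sum_(i <- r) nrm (F i).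
Proof.
elim: r => [|i r IH]; first by rewrite !big_nil nrm0.
by rewrite !big_cons (le_trans (nrmD _ _))// lerD2l.
Qed.

Lemma nrm_mxtrace n (M : 'M[K]_n) : `|\tr M| <= nrm M.
Proof.
rewrite /mxtrace (le_trans (ler_norm_sum _ _ _))//; apply: ler_sum => i _.
by rewrite (bigD1 i)//= lerDl sumr_ge0.
Qed.

Lemma nrm_gt0 m n (M : 'M[K]_(m, n)) : M != 0 -> 0 < nrm M.
Proof.
move=> M0; rewrite lt_neqAle nrm_ge0 andbT eq_sym; apply: contra M0 => /eqP M0.
apply/eqP/matrixP => i j; rewrite mxE; apply/eqP.
by rewrite -normr_eq0 eq_le normr_ge0 andbT -M0 le_nrm.
Qed.

Lemma nrmZ m n (a : K) (M : 'M[K]_(m, n)) : nrm (a *: M) = `|a| * nrm M.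
Proof.
rewrite /nrm mulr_sumr; apply: eq_bigr => i _; rewrite mulr_sumr.
by apply: eq_bigr => j _; rewrite mxE normrM.
Qed.

(** A left eigenvector gives [v F^p = z^p v], and submultiplicativity lets [nrm v] be cancelled.
    With [p] free, this serves both the spectral radius and the invertibility of [1 - F]. *)
Lemma eigenvalue_exp_nrm n (F : 'M[K]_n) (v : 'rV[K]_n) (z : K) (p : nat) :
  v != 0 -> v *m F = z *: v -> `|z| ^+ p <= nrm (F ^+ p).
Proof.
move=> v0 vF.
have vFp : v *m F ^+ p = z ^+ p *: v.
  elim: p => [|p IH]; first by rewrite !expr0 scale1r mulmx1.
  by rewrite exprSr [F ^+ p * F]/(F ^+ p *m F) mulmxA IH -scalemxAl vF scalerA exprSr.
rewrite -(ler_pM2l (nrm_gt0 v0)) (le_trans _ (nrmM _ _))//.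
by rewrite vFp nrmZ normrX mulrC.
Qed.

End EntrywiseNorm.

(** * Powers of a matrix with spectral radius below one *)

Section GeometricDecay.
Variable K : numFieldType.

(** Stated over any numeric field so as to cover complex sequences; the order of [R[i]] then forces
    [c] and [r] to be real. *)
Definition geometric_decay (u : nat -> K) : Prop :=
  exists c r : K, [/\ 0 <= c, 0 < r < 1 & forall k, `|u k| <= c * r ^+ k].

Lemma geometric_decay0 : geometric_decay (fun=> 0).
Proof.
exists 0, 2^-1; split => // [|k]; last by rewrite normr0 mul0r.
by rewrite invr_gt0 ltr0n invf_lt1 ?ltr1n// ltr0n.
Qed.

Lemma geometric_decay_recurrence (a u : nat -> K) (z : K) : `|z| < 1 ->
  geometric_decay u -> (forall k, a k.+1 = z * a k + u k) -> geometric_decay a.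
Proof.
move=> z1 [c [r [c0 /andP[r0 r1] ucr]]] aE.
(* This common rate satisfies r <= s and |z| < s < 1. *)
pose s : K := 1 - (1 - `|z|) * (1 - r).
have zrE : s - `|z| = r * (1 - `|z|) by rewrite /s; ring.
have zs : 0 < s - `|z| by rewrite zrE mulr_gt0// subr_gt0.
have rs : r <= s.
  have -> : s = r + `|z| * (1 - r) by rewrite /s; ring.
  by rewrite lerDl mulr_ge0// subr_ge0 ltW.
have s1 : s < 1 by rewrite /s ltrBlDr ltrDl mulr_gt0// subr_gt0.
have s0 : 0 < s by rewrite (lt_le_trans r0).
(* This [C] dominates [a 0] and satisfies [c <= C * (s - |z|)], which closes the induction. *)
pose C : K := `|a 0%N| + c / (s - `|z|).
have C0 : 0 <= C by rewrite addr_ge0// divr_ge0// ltW.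
exists C, s; split => //; first by rewrite s0.
elim=> [|k IH]; first by rewrite expr0 mulr1 lerDl divr_ge0// ltW.
rewrite aE (le_trans (ler_normD _ _))// normrM exprS.
apply: (@le_trans _ _ (`|z| * (C * s ^+ k) + c * s ^+ k)).
  apply: lerD; first by rewrite ler_wpM2l.
  by rewrite (le_trans (ucr k))// ler_wpM2l// lerXn2r// nnegrE ltW.
have -> : `|z| * (C * s ^+ k) + c * s ^+ k = (C * `|z| + c) * s ^+ k by ring.
rewrite mulrA ler_wpM2r ?exprn_ge0 ?(ltW s0)//.
rewrite addrC -lerBrDr -mulrBr /C mulrDl divfK ?gt_eqF//.
by rewrite lerDr mulr_ge0// ltW.
Qed.

(** Induction on the list of roots stands in for the Jordan form. Peeling off [z] leaves
    [(F - z) M], annihilated by the remaining factors, and [F^(k+1) M = z F^k M + F^k (F - z) M] is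
    a scalar recurrence in each entry. *)
Lemma geometric_decay_mxpow n (F : 'M[K]_n.+1) (s : seq K) :
  (forall z, z \in s -> `|z| < 1) ->
  forall p (M : 'M[K]_(n.+1, p)),
  horner_mx F (\prod_(z <- s) ('X - z%:P)) *m M = 0 ->
  forall i j, geometric_decay (fun k => (F ^+ k *m M) i j).
Proof.
elim: s => [_ p M|z s IH s1 p M].
  rewrite big_nil rmorph1 mul1mx => -> i j.
  rewrite (_ : (fun _ => _) = fun=> 0); first exact: geometric_decay0.
  by apply/funext => k; rewrite mulmx0 mxE.
rewrite big_cons mulrC rmorphM/= rmorphB/= horner_mx_X horner_mx_C => sM i j.
have {}sM : horner_mx F (\prod_(z <- s) ('X - z%:P)) *m ((F - z%:M) *m M) = 0.
  by rewrite mulmxA.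
apply: (@geometric_decay_recurrence _ (fun k => (F ^+ k *m ((F - z%:M) *m M)) i j) z).
- by apply: s1; rewrite mem_head.
- by apply: (IH _ _ _ sM) => x xs; apply: s1; rewrite inE xs orbT.
- move=> k; have -> : F ^+ k.+1 *m M = z *: (F ^+ k *m M) + F ^+ k *m ((F - z%:M) *m M).
    rewrite exprSr -mulmxA mulmxBl mulmxBr mul_scalar_mx -scalemxAr.
    by rewrite addrC subrK.
  by rewrite [LHS]mxE; congr (_ + _); rewrite [LHS]mxE.
Qed.

End GeometricDecay.

(** * Spectral radius and decay of powers *)

Section Stability.
Variable R : realType.
Local Notation C := R[i].
Local Notation toC := (real_complex R).

Let normcE (z : C) : `|z| = (ComplexField.Normc.normc z)%:C%C.
Proof. by case: z. Qed.

Let nrm_toC m n (M : 'M[R]_(m, n)) : nrm (map_mx toC M) = toC (nrm M).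
Proof.
rewrite /nrm rmorph_sum/=; apply: eq_bigr => i _.
rewrite rmorph_sum/=; apply: eq_bigr => j _.
by rewrite mxE normc_def/= expr0n/= addr0 sqrtr_sqr.
Qed.

Let map_mx_exp n (F : 'M[R]_n) p : map_mx toC F ^+ p = map_mx toC (F ^+ p).
Proof.
elim: p => [|p IH]; first by rewrite !expr0 map_mx1.
by rewrite !exprS IH map_mxM.
Qed.

Lemma eigenvalue_normc_exp n (F : 'M[R]_n) (z : C) p :
  eigenvalue (map_mx toC F) z ->
  ComplexField.Normc.normc z ^+ p <= nrm (F ^+ p).
Proof.
move=> /eigenvalueP[v vF v0]; rewrite -lecR rmorphXn/= -normcE.
by rewrite -nrm_toC -map_mx_exp (eigenvalue_exp_nrm _ v0 vF).
Qed.

Lemma eigenvalue_lt1 n (F : 'M[R]_n) (z : C) :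
  spectral_radius F < 1 -> eigenvalue (map_mx toC F) z -> `|z| < 1.
Proof.
move=> F1 zF; rewrite normcE -[1]/(1%:C%C) ltcR.
apply: le_lt_trans F1; apply: ub_le_sup; last by exists z.
(* The supremum dominates its elements only for a bounded set; exponent 1 in the eigenvalue estimate
   supplies the bound. *)
exists (nrm F) => _ [y /= yF <-].
by have := eigenvalue_normc_exp 1 yF; rewrite !expr1.
Qed.

(** Over the complex numbers the characteristic polynomial splits, its roots are eigenvalues of
    modulus below 1, and by Cayley-Hamilton it annihilates [F]; so every entry of [F^k] decays
    geometrically. *)
Lemma mxpow_geometric n (F : 'M[R]_n) : spectral_radius F < 1 ->
  exists c r : R, [/\ 0 <= c, 0 < r < 1 & forall k, nrm (F ^+ k) <= c * r ^+ k].
Proof.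
move=> F1; case: n F F1 => [F _|n F F1].
  exists 0, 2^-1; split => // [|k]; last by rewrite /nrm big_ord0 mul0r.
  by rewrite invr_gt0 ltr0n invf_lt1 ?ltr1n// ltr0n.
have entry i j : exists c r : R,
    [/\ 0 <= c, 0 < r < 1 & forall k, `|(F ^+ k) i j| <= c * r ^+ k].
  have [s sE] := closed_field_poly_normal (char_poly (map_mx toC F)).
  have s1 z : z \in s -> `|z| < 1.
    move=> zs; apply: eigenvalue_lt1 F1 _.
    rewrite eigenvalue_root_char sE (monicP (char_poly_monic _)) scale1r.
    by rewrite root_prod_XsubC.
  have s0 : horner_mx (map_mx toC F) (\prod_(z <- s) ('X - z%:P)) *m 1%:M = 0.
    rewrite mulmx1 -[RHS](Cayley_Hamilton (map_mx toC F)).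
    by rewrite [in RHS]sE (monicP (char_poly_monic _)) scale1r.
  have [c [r [c0 /andP[r0 r1] Fk]]] := geometric_decay_mxpow s1 s0 i j.
  (* A comparison in [R[i]] forces equal imaginary parts, so [0 <= c] makes [c] real, and likewise
     for [r]. *)
  have cE : c = (complex.Re c)%:C%C.
    by move: c0; case: (c) => a b; rewrite lecE/= => /andP[/eqP ->].
  have rE : r = (complex.Re r)%:C%C.
    by move: r0; case: (r) => a b; rewrite ltcE/= => /andP[/eqP ->].
  exists (complex.Re c), (complex.Re r); split.
  - by rewrite -lecR -cE.
  - by rewrite -!ltcR -rE r0.
  - move=> k; have := Fk k; rewrite mulmx1 map_mx_exp mxE normc_def/= expr0n/=.
    rewrite addr0 sqrtr_sqr.
    by rewrite cE rE -rmorphXn -rmorphM lecR.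
have {}entry (ij : 'I_n.+1 * 'I_n.+1) : exists cr : R * R,
    [/\ 0 <= cr.1, 0 < cr.2 < 1 & forall k, `|(F ^+ k) ij.1 ij.2| <= cr.1 * cr.2 ^+ k].
  by have [c [r crP]] := entry ij.1 ij.2; exists (c, r).
have [f fP] := choice entry.
(* The worst rate over all entries; the base value 1/2 lies strictly between 0 and 1, so the maximum
   does too. *)
pose r := \big[Num.max/2^-1]_ij (f ij).2.
have r2 : 2^-1 <= r by rewrite /r bigmax_ge_id.
have r0 : 0 < r by rewrite (lt_le_trans _ r2)// invr_gt0 ltr0n.
exists (\sum_i \sum_j (f (i, j)).1), r; split.
- by apply: sumr_ge0 => i _; apply: sumr_ge0 => j _; case: (fP (i, j)).
- rewrite r0/=; apply/bigmax_ltP; split; last by move=> ij _; have [_ /andP[]] := fP ij.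
  by rewrite invf_lt1 ?ltr1n// ltr0n.
- move=> k; rewrite mulr_suml; apply: ler_sum => i _.
  rewrite mulr_suml; apply: ler_sum => j _.
  have [c0 /andP[rij _] /(_ k) /= le] := fP (i, j); rewrite (le_trans le)//.
  rewrite ler_wpM2l// lerXn2r ?nnegrE ?(ltW rij) ?(ltW r0)//.
  by apply/bigmax_geP; right; exists (i, j).
Qed.

(** Every eigenvalue satisfies [|z|^p <= 1/2 <= (1 - 1/(2p))^p], so [1 - 1/(2p)] bounds all moduli
    at once and strictness survives the supremum. *)
Lemma spectral_radius_lt1 n (F : 'M[R]_n) p : (0 < p)%N ->
  nrm (F ^+ p) <= 2^-1 -> spectral_radius F < 1.
Proof.
move=> p0 Fp; rewrite /spectral_radius.
set E := [set _ | _ in _]; have [->|/set0P E0] := eqVneq E set0.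
  by rewrite sup0 ltr01.
have p1 : 0 < p%:R :> R by rewrite ltr0n.
(* Bernoulli's inequality: (1 - 1/(2p))^p >= 1/2. *)
pose c : R := 1 - (2 * p%:R)^-1.
have c0 : 0 <= c.
  rewrite subr_ge0 invf_le1 ?mulr_gt0//.
  by rewrite -natrM ler1n muln_gt0.
have bern k : 1 - k%:R * (2 * p%:R)^-1 <= c ^+ k.
  elim: k => [|k IH]; first by rewrite mul0r subr0 expr0.
  have ip : 0 <= (2 * p%:R)^-1 :> R by rewrite invr_ge0 mulr_ge0.
  have /(le_trans _) : c * (1 - k%:R * (2 * p%:R)^-1) <= c * c ^+ k by rewrite ler_wpM2l.
  rewrite -exprS; apply; rewrite -natr1 /c; set q := (2 * _)^-1 in ip *.
  have -> : (1 - q) * (1 - k%:R * q) = 1 - (k%:R + 1) * q + k%:R * (q * q) by ring.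
  by rewrite lerDl !mulr_ge0.
have cp : 2^-1 <= c ^+ p.
  have := bern p; rewrite invfM mulrCA divff ?gt_eqF// mulr1.
  by rewrite (_ : 1 - 2^-1 = 2^-1 :> R)//; field.
apply: (@le_lt_trans _ _ c); last first.
  by rewrite /c ltrBlDr ltrDl invr_gt0 mulr_gt0.
apply: ge_sup => // _ [z /= zF <-].
have /le_trans/(_ (le_trans Fp cp)) := eigenvalue_normc_exp p zF.
rewrite ler_pXn2r// nnegrE; case: (z) => a b; exact: sqrtr_ge0.
Qed.

End Stability.

(** * Expectations and i.i.d. noise *)

Section ExpectationLaw.
Context d (Omega : measurableType d) (R : realType) (P : probability Omega R).
Implicit Types X Y : Omega -> R.

Lemma Lfun_measurable p X : X \in Lfun P p -> measurable_fun setT X.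
Proof. by move=> /sub_Lfun_mfun; rewrite inE. Qed.

Lemma Lfun2_Lfun1 X : X \in Lfun P 2%:E -> X \in Lfun P 1.
Proof. by apply: Lfun_subset12; exact: fin_num_measure. Qed.

Lemma expectation_eq_law X Y : X \in Lfun P 1 -> Y \in Lfun P 1 ->
  (forall A, measurable A -> P (X @^-1` A) = P (Y @^-1` A)) ->
  ('E_P[X] = 'E_P[Y])%E.
Proof.
move=> X1 Y1 XY.
pose X' : {mfun Omega >-> R} := HB.pack X
  (isMeasurableFun.Build _ _ _ _ _ (Lfun_measurable X1)).
pose Y' : {mfun Omega >-> R} := HB.pack Y
  (isMeasurableFun.Build _ _ _ _ _ (Lfun_measurable Y1)).
rewrite unlock.
rewrite -[LHS](@integral_distribution _ _ _ _ _ P X' EFin)//; last exact/Lfun1_integrable.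
rewrite -[RHS](@integral_distribution _ _ _ _ _ P Y' EFin)//; last exact/Lfun1_integrable.
by apply: eq_measure_integral => A mA _; exact: XY.
Qed.

(** Independence on rectangles identifies the joint law with the product of the marginals; Fubini
    then factors the integral of [x * y]. *)
Lemma expectation_indep_mul X Y : X \in Lfun P 2%:E -> Y \in Lfun P 2%:E ->
  (forall A B, measurable A -> measurable B ->
     P (X @^-1` A `&` Y @^-1` B) = (P (X @^-1` A) * P (Y @^-1` B))%E) ->
  ('E_P[X \* Y] = 'E_P[X] * 'E_P[Y])%E.
Proof.
move=> X2 Y2 XY.
have X1 := Lfun2_Lfun1 X2; have Y1 := Lfun2_Lfun1 Y2.
have mX := Lfun_measurable X1; have mY := Lfun_measurable Y1.
pose X' : {mfun Omega >-> R} := HB.pack X (isMeasurableFun.Build _ _ _ _ _ mX).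
pose Y' : {mfun Omega >-> R} := HB.pack Y (isMeasurableFun.Build _ _ _ _ _ mY).
have mZ : measurable_fun setT (fun o => (X o, Y o)) by exact: measurable_fun_pair.
pose Z : {mfun Omega >-> (R * R)%type} :=
  HB.pack (fun o => (X o, Y o)) (isMeasurableFun.Build _ _ _ _ _ mZ).
pose f (z : R * R) : \bar R := (z.1 * z.2)%:E.
have mf : measurable_fun [set: R * R] f.
  by apply/measurable_EFinP; apply: measurable_funM.
have fZ : P.-integrable setT (f \o Z).
  exact/Lfun1_integrable/Lfun2_mul_Lfun1.
have law A : measurable A ->
    (distribution P X' \x distribution P Y')%E A = distribution P Z A.
  by apply: product_measure_unique => B C mB mC; exact: XY.
have law_int g : (\int[distribution P X' \x distribution P Y']_z g z =
    \int[distribution P Z]_z g z)%E.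
  by apply: eq_measure_integral => A mA _; exact: law.
have fXY : (distribution P X' \x distribution P Y')%E.-integrable setT f.
  apply/integrableP; split => //; rewrite law_int.
  rewrite ge0_integral_distribution//; last exact: measurableT_comp.
  by case/integrableP : fZ.
have EXE : ('E_P[X] = \int[distribution P X']_x x%:E)%E.
  rewrite unlock -[LHS](@integral_distribution _ _ _ _ _ P X' EFin)//.
  exact/Lfun1_integrable.
have EYE : ('E_P[Y] = \int[distribution P Y']_x x%:E)%E.
  rewrite unlock -[LHS](@integral_distribution _ _ _ _ _ P Y' EFin)//.
  exact/Lfun1_integrable.
have iX : (distribution P X').-integrable setT EFin.
  by apply: integrable_pushforward => //; exact/Lfun1_integrable.
have iY : (distribution P Y').-integrable setT EFin.
  by apply: integrable_pushforward => //; exact/Lfun1_integrable.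
transitivity (\int[distribution P Z]_z f z)%E.
  by rewrite integral_distribution// unlock.
rewrite -law_int -integral12_prod_meas1//.
have EYfin := expectation_fin_num Y1.
transitivity (\int[distribution P X']_x (x%:E * (fine 'E_P[Y])%:E))%E.
  apply: eq_integral => x _; rewrite fineK// EYE -integralZl//.
by rewrite integralZr// fineK// EXE.
Qed.

End ExpectationLaw.

(** * Real-valued expectation *)

Section RealExpectation.
Context d (Omega : measurableType d) (R : realType) (P : probability Omega R).
Implicit Types X Y : Omega -> R.

(** [fine] sends infinite values to 0, whence the integrability hypotheses in the linearity
    rules. *)
Definition Er X : R := fine 'E_P[X]%E.

Lemma ErD X Y : X \in Lfun P 1 -> Y \in Lfun P 1 ->
  Er (fun o => X o + Y o) = Er X + Er Y.
Proof.
by move=> X1 Y1; rewrite /Er expectationD// fineD// expectation_fin_num.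
Qed.

Lemma Er_cst (c : R) : Er (fun=> c) = c.
Proof. by rewrite /Er (expectation_cst P c). Qed.

Lemma ErZ (c : R) X : X \in Lfun P 1 -> Er (fun o => c * X o) = c * Er X.
Proof.
move=> X1; have -> : (fun o => c * X o) = c \o* X.
  by apply/funext => o /=; rewrite mulrC.
by rewrite /Er expectationZl// fineM// expectation_fin_num.
Qed.

Lemma Lfun_sum p (I : Type) (r : seq I) (F : I -> Omega -> R) : (1 <= p)%E ->
  (forall i, F i \in Lfun P p) -> (fun o => \sum_(i <- r) F i o) \in Lfun P p.
Proof.
move=> p1 FP; have -> : (fun o => \sum_(i <- r) F i o) = \sum_(i <- r) F i.
  by apply/funext => o; rewrite fct_sumE.
exact: rpred_sum.
Qed.

Lemma LfunZ p (c : R) X : (1 <= p)%E ->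
  X \in Lfun P p -> (fun o => c * X o) \in Lfun P p.
Proof. by move=> p1 XP; exact: (@rpredZ _ _ (Lfun P p) c). Qed.

Lemma LfunD p X Y : (1 <= p)%E -> X \in Lfun P p -> Y \in Lfun P p ->
  (fun o => X o + Y o) \in Lfun P p.
Proof. by move=> p1 XP YP; exact: (@rpredD _ (Lfun P p)). Qed.

Lemma Er_sum (I : Type) (r : seq I) (F : I -> Omega -> R) :
  (forall i, F i \in Lfun P 1) ->
  Er (fun o => \sum_(i <- r) F i o) = \sum_(i <- r) Er (F i).
Proof.
move=> F1; elim: r => [|i r IH].
  by under [X in Er X]eq_fun do rewrite big_nil; rewrite Er_cst big_nil.
under [X in Er X]eq_fun do rewrite big_cons.
by rewrite ErD// ?IH ?big_cons//; exact: Lfun_sum.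
Qed.

Lemma Er_ge0 X : (forall o, 0 <= X o) -> 0 <= Er X.
Proof. by move=> X0; apply: fine_ge0; exact: expectation_ge0. Qed.

Lemma Lfun2_mul X Y : X \in Lfun P 2%:E -> Y \in Lfun P 2%:E ->
  (fun o => X o * Y o) \in Lfun P 1.
Proof. by move=> X2 Y2; exact: Lfun2_mul_Lfun1. Qed.

Lemma Er_le X Y : X \in Lfun P 1 -> Y \in Lfun P 1 ->
  (forall o, X o <= Y o) -> Er X <= Er Y.
Proof.
move=> X1 Y1 XY; rewrite -subr_ge0.
have <- : Er (fun o => Y o - X o) = Er Y - Er X.
  rewrite ErD//; last by rewrite -[fun _ => _]/(- X) rpredN.
  by congr (_ + _); under [X in Er X]eq_fun do rewrite -mulN1r; rewrite ErZ// mulN1r.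
by apply: Er_ge0 => o; rewrite subr_ge0.
Qed.

(** A crude Cauchy-Schwarz inequality, from [|x y| <= x^2 + y^2] pointwise. *)
Lemma Er_mul_le X Y : X \in Lfun P 2%:E -> Y \in Lfun P 2%:E ->
  `|Er (fun o => X o * Y o)| <=
    Er (fun o => X o * X o) + Er (fun o => Y o * Y o).
Proof.
move=> X2 Y2.
have XY1 := Lfun2_mul X2 Y2; have XX1 := Lfun2_mul X2 X2; have YY1 := Lfun2_mul Y2 Y2.
rewrite -ErD// ler_norml; apply/andP; split; last first.
  by apply: Er_le => // [|o]; [exact: LfunD|nra].
rewrite lerNl -mulN1r -ErZ//; apply: Er_le => // [||o]; [exact: LfunZ|exact: LfunD|nra].
Qed.

End RealExpectation.

(** * First and second moments of the noise *)

Section IidMoments.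
Context d (Omega : measurableType d) (R : realType) (P : probability Omega R).

(** Open intervals generate the measurable sets of the line and have open preimages. This carries
    the i.i.d. hypotheses over to continuous real functions of the noise. *)
Lemma borel_preimage n (f : 'cV[R]_n -> R) : continuous f ->
  forall A, measurable A -> borel (f @^-1` A).
Proof.
move=> /continuousP cf A mA.
have /(_ measurableT A mA) : measurable_fun setT
    (f : g_sigma_algebraType (@open 'cV[R]_n) -> R).
  apply: (measurability _ (RGenOpens.measurableE R)).
  move=> _ [_ [a [b ->]] <-]; rewrite setTI.
  by apply: sub_sigma_algebra; apply: cf; exact: itv_open.
by rewrite setTI.
Qed.

Variables (n : nat) (w : nat -> Omega -> 'cV[R]_n).
Hypothesis w_iid : iid P w.
Hypothesis w_moment : forall t, finite_moment P 4 (w t).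

Lemma w_Lfun2 t i : (fun o => w t o i 0) \in Lfun P 2%:E.
Proof.
apply: (@Lfun_subset _ _ _ P 2%:E (4%:R)%:E) (w_moment t i).
- by rewrite lee1n.
- by rewrite lee1n.
- exact: fin_num_measure.
- by rewrite lee_fin ler_nat.
Qed.

Lemma iid_law (f : 'cV[R]_n -> R) t : continuous f ->
  forall A, measurable A -> P ((f \o w t) @^-1` A) = P ((f \o w 0) @^-1` A).
Proof.
by move=> cf A mA; have [_ _ law] := w_iid; exact: law (borel_preimage cf mA).
Qed.

Lemma iid_indep2 (f g : 'cV[R]_n -> R) s t : s != t ->
  continuous f -> continuous g -> forall A B, measurable A -> measurable B ->
  P ((f \o w s) @^-1` A `&` (g \o w t) @^-1` B) =
  (P ((f \o w s) @^-1` A) * P ((g \o w t) @^-1` B))%E.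
Proof.
move=> st cf cg A B mA mB; have [_ ind _] := w_iid.
pose E k := if k == s then f @^-1` A else g @^-1` B.
have := ind [:: s; t] E.
rewrite !big_cons !big_nil setIT mule1 /E eqxx (negbTE (_ : t != s)) 1?eq_sym//.
apply; first by rewrite /= inE st.
by move=> k; case: ifP => _; exact: borel_preimage.
Qed.

(** Centred at the mean of [w 0], as in [covmx]; under the i.i.d. hypothesis this is the mean at
    every time. *)
Definition noise t o : 'cV[R]_n := w t o - Emx P (w 0%N).

Lemma noise_Lfun2 t i : (fun o => noise t o i 0) \in Lfun P 2%:E.
Proof.
have -> : (fun o => noise t o i 0) = (fun o => w t o i 0 + - Emx P (w 0%N) i 0).
  by apply/funext => o; rewrite !mxE.
by apply: LfunD (w_Lfun2 t i) (Lfun_cst _ _ _) => //; rewrite lee1n.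
Qed.

Lemma entry_sub_continuous (c : R) (i : 'I_n) :
  continuous (fun x : 'cV[R]_n => x i 0 - c).
Proof.
by move=> x; apply: cvgB (@coord_continuous R n 1 i 0 x) (cvg_cst _).
Qed.

Lemma noiseE t i : (fun o => noise t o i 0) =
  (fun x : 'cV[R]_n => x i 0 - Emx P (w 0%N) i 0) \o w t.
Proof. by apply/funext => o; rewrite !mxE. Qed.

Lemma Er_noise t i : Er P (fun o => noise t o i 0) = 0.
Proof.
have -> : Er P (fun o => noise t o i 0) = Er P (fun o => noise 0 o i 0).
  rewrite /Er; congr fine; apply: expectation_eq_law.
  - exact/Lfun2_Lfun1/noise_Lfun2.
  - exact/Lfun2_Lfun1/noise_Lfun2.
  - by rewrite !noiseE; apply: iid_law; exact: entry_sub_continuous.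
have -> : (fun o => noise 0 o i 0) = (fun o => w 0 o i 0 + - Emx P (w 0%N) i 0).
  by apply/funext => o; rewrite !mxE.
rewrite ErD ?Er_cst ?mxE ?subrr//; first exact/Lfun2_Lfun1/w_Lfun2.
exact: (Lfun_cst P _ 1).
Qed.

(** At distinct times independence factors the expectation into two zero means; at equal times the
    law can be moved to time 0, where [covmx] is read off. *)
Lemma Er_noise_mul s t i j :
  Er P (fun o => noise s o i 0 * noise t o j 0) =
  if s == t then covmx P (w 0%N) i j else 0.
Proof.
have [<-{t}|st] := eqVneq s t; last first.
  have := expectation_indep_mul (noise_Lfun2 s i) (noise_Lfun2 t j).
  rewrite /Er => ->; last first.
    by rewrite !noiseE; apply: iid_indep2 => //; exact: entry_sub_continuous.
  have nfin k l := expectation_fin_num (Lfun2_Lfun1 (noise_Lfun2 k l)).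
  rewrite fineM//.
  by rewrite [fine _]Er_noise mul0r.
have -> : covmx P (w 0%N) i j = Er P (fun o => noise 0 o i 0 * noise 0 o j 0).
  rewrite mxE /Er; congr (fine (expectation P _)); apply/funext => o.
  by rewrite mxE big_ord1 /centered /noise !mxE.
pose f (x : 'cV[R]_n) := (x i 0 - Emx P (w 0%N) i 0) * (x j 0 - Emx P (w 0%N) j 0).
have fE t : (fun o => noise t o i 0 * noise t o j 0) = f \o w t.
  by apply/funext => o; rewrite /f/= !mxE.
rewrite /Er; congr fine; apply: expectation_eq_law.
- by apply: Lfun2_mul; exact: noise_Lfun2.
- by apply: Lfun2_mul; exact: noise_Lfun2.
- rewrite !fE; apply: iid_law => x.
  exact: cvgM (@entry_sub_continuous _ i x) (@entry_sub_continuous _ j x).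
Qed.

End IidMoments.

(** * Means and second-moment matrices of random vectors *)

Section VectorMoments.
Context d (Omega : measurableType d) (R : realType) (P : probability Omega R).

Definition L2vec n (x : Omega -> 'cV[R]_n) : Prop :=
  forall i, (fun o => x o i 0) \in Lfun P 2%:E.

Definition mean n (x : Omega -> 'cV[R]_n) : 'cV[R]_n :=
  \col_i Er P (fun o => x o i 0).

(** The second-moment matrix [E[x y^T]], without centring. *)
Definition cross n p (x : Omega -> 'cV[R]_n) (y : Omega -> 'cV[R]_p) : 'M[R]_(n, p) :=
  \matrix_(i, j) Er P (fun o => x o i 0 * y o j 0).

Let one_le2 : (1 <= 2%:E :> \bar R)%E. Proof. by rewrite lee1n. Qed.

Lemma L2vecD n (x y : Omega -> 'cV[R]_n) :
  L2vec x -> L2vec y -> L2vec (fun o => x o + y o).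
Proof.
move=> x2 y2 i; under eq_fun do rewrite mxE.
by apply: LfunD.
Qed.

Lemma mulmx_entry n p (M : 'M[R]_(n, p)) (x : Omega -> 'cV[R]_p) i :
  (fun o => (M *m x o) i 0) = (fun o => \sum_k M i k * x o k 0).
Proof. by apply/funext => o; rewrite mxE. Qed.

Lemma L2vecM n p (M : 'M[R]_(n, p)) (x : Omega -> 'cV[R]_p) :
  L2vec x -> L2vec (fun o => M *m x o).
Proof.
move=> x2 i; rewrite mulmx_entry; apply: Lfun_sum => // k; exact: LfunZ.
Qed.

Lemma L2vec_cst n (c : 'cV[R]_n) : L2vec (fun=> c).
Proof. by move=> i; exact: Lfun_cst. Qed.

Lemma mean_cst n (c : 'cV[R]_n) : mean (fun=> c) = c.
Proof. by apply/colP => i; rewrite mxE Er_cst. Qed.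

Lemma cross0l n p (y : Omega -> 'cV[R]_p) : cross (fun=> 0 : 'cV[R]_n) y = 0.
Proof.
apply/matrixP => i j; rewrite !mxE.
rewrite -[RHS](Er_cst P 0); congr (Er P _); apply/funext => o.
by rewrite mul0r.
Qed.

Lemma meanD n (x y : Omega -> 'cV[R]_n) : L2vec x -> L2vec y ->
  mean (fun o => x o + y o) = mean x + mean y.
Proof.
move=> x2 y2; apply/colP => i; rewrite !mxE.
under [X in Er _ X]eq_fun do rewrite mxE.
by rewrite ErD//; exact: Lfun2_Lfun1.
Qed.

Lemma meanM n p (M : 'M[R]_(n, p)) (x : Omega -> 'cV[R]_p) : L2vec x ->
  mean (fun o => M *m x o) = M *m mean x.
Proof.
move=> x2; apply/colP => i; rewrite !mxE mulmx_entry.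
have x1 k : (fun o => x o k 0) \in Lfun P 1 by exact: Lfun2_Lfun1.
rewrite Er_sum => [|k]; last exact: LfunZ.
by apply: eq_bigr => k _; rewrite mxE ErZ.
Qed.

Lemma crossDl n p (x y : Omega -> 'cV[R]_n) (z : Omega -> 'cV[R]_p) :
  L2vec x -> L2vec y -> L2vec z ->
  cross (fun o => x o + y o) z = cross x z + cross y z.
Proof.
move=> x2 y2 z2; apply/matrixP => i j; rewrite !mxE.
under [X in Er _ X]eq_fun do rewrite mxE mulrDl.
by rewrite ErD//; exact: Lfun2_mul.
Qed.

Lemma crossT n p (x : Omega -> 'cV[R]_n) (z : Omega -> 'cV[R]_p) :
  (cross x z)^T = cross z x.
Proof.
by apply/matrixP => i j; rewrite !mxE; under [X in Er _ X]eq_fun do rewrite mulrC.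
Qed.

Lemma crossDr n p (x y : Omega -> 'cV[R]_n) (z : Omega -> 'cV[R]_p) :
  L2vec x -> L2vec y -> L2vec z ->
  cross z (fun o => x o + y o) = cross z x + cross z y.
Proof.
by move=> x2 y2 z2; rewrite -crossT crossDl// linearD/= !crossT.
Qed.

Lemma crossMl n p q (M : 'M[R]_(q, n)) (x : Omega -> 'cV[R]_n) (z : Omega -> 'cV[R]_p) :
  L2vec x -> L2vec z -> cross (fun o => M *m x o) z = M *m cross x z.
Proof.
move=> x2 z2; apply/matrixP => i j; rewrite !mxE.
have xz k : (fun o => x o k 0 * z o j 0) \in Lfun P 1 by exact: Lfun2_mul.
have -> : (fun o => (M *m x o) i 0 * z o j 0) =
    (fun o => \sum_k M i k * (x o k 0 * z o j 0)).
  by apply/funext => o; rewrite mxE mulr_suml; apply: eq_bigr => k _; rewrite mulrA.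
rewrite Er_sum => [|k]; last exact: LfunZ.
by apply: eq_bigr => k _; rewrite mxE ErZ.
Qed.

Lemma crossMr n p q (M : 'M[R]_(q, n)) (x : Omega -> 'cV[R]_n) (z : Omega -> 'cV[R]_p) :
  L2vec x -> L2vec z -> cross z (fun o => M *m x o) = cross z x *m M^T.
Proof. by move=> x2 z2; rewrite -crossT crossMl// trmx_mul crossT. Qed.

Lemma bilinE n p (M : 'M[R]_(n, p)) (x : 'cV[R]_n) (y : 'cV[R]_p) :
  (x^T *m M *m y) 0 0 = \sum_i \sum_j M i j * (y j 0 * x i 0).
Proof.
rewrite -mulmxA mxE; apply: eq_bigr => i _; rewrite !mxE mulr_sumr.
by apply: eq_bigr => j _; ring.
Qed.

Lemma bilin_Lfun1 n p (M : 'M[R]_(n, p)) (x : Omega -> 'cV[R]_n) (y : Omega -> 'cV[R]_p) :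
  L2vec x -> L2vec y -> (fun o => ((x o)^T *m M *m y o) 0 0) \in Lfun P 1.
Proof.
move=> x2 y2; under eq_fun do rewrite bilinE.
by do 2!(apply: Lfun_sum => // ?); apply: LfunZ => //; exact: Lfun2_mul.
Qed.

Lemma Er_bilin n p (M : 'M[R]_(n, p)) (x : Omega -> 'cV[R]_n) (y : Omega -> 'cV[R]_p) :
  L2vec x -> L2vec y ->
  Er P (fun o => ((x o)^T *m M *m y o) 0 0) = \tr (M *m cross y x).
Proof.
move=> x2 y2; under [X in Er _ X]eq_fun do rewrite bilinE.
have yx1 i j : (fun o => y o j 0 * x o i 0) \in Lfun P 1 by exact: Lfun2_mul.
rewrite Er_sum => [|i]; last by apply: Lfun_sum => // j; exact: LfunZ.
rewrite /mxtrace; apply: eq_bigr => i _; rewrite mxE Er_sum => [|j]; last exact: LfunZ.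
by apply: eq_bigr => j _; rewrite mxE ErZ.
Qed.

Lemma Er_lin n (q : 'rV[R]_n) (x : Omega -> 'cV[R]_n) : L2vec x ->
  Er P (fun o => (q *m x o) 0 0) = (q *m mean x) 0 0.
Proof. by move=> x2; rewrite -meanM// [RHS]mxE. Qed.

(** Used to control, uniformly in time, the correlation between the noise-driven state and the
    initial error. *)
Lemma nrm_cross n p (x : Omega -> 'cV[R]_n) (y : Omega -> 'cV[R]_p) :
  L2vec x -> L2vec y ->
  nrm (cross x y) <= (nrm (cross x x) + nrm (cross y y)) * (n * p)%:R.
Proof.
move=> x2 y2.
have le i j : `|cross x y i j| <= nrm (cross x x) + nrm (cross y y).
  rewrite mxE (le_trans (Er_mul_le (x2 i) (y2 j)))// lerD//.
    by rewrite (le_trans _ (le_nrm _ i i))// mxE ler_norm.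
  by rewrite (le_trans _ (le_nrm _ j j))// mxE ler_norm.
rewrite /nrm (le_trans (ler_sum _ (fun i _ => ler_sum _ (fun j _ => le i j))))//.
by rewrite !sumr_const !card_ord -mulrnA mulr_natr mulnC.
Qed.

End VectorMoments.

(** * Covariance of the noise-driven part of the state *)

Section Fluctuation.
Context d (Omega : measurableType d) (R : realType) (P : probability Omega R).
Variables (n : nat) (w : nat -> Omega -> 'cV[R]_n).
Hypothesis w_iid : iid P w.
Hypothesis w_moment : forall t, finite_moment P 4 (w t).
Variable F : 'M[R]_n.

Local Notation W := (covmx P (w 0%N)).
Local Notation xi := (noise P w).

(** Response of the closed loop to the centred noise alone, from a zero initial state. *)
Fixpoint fluct t o : 'cV[R]_n :=
  if t is t'.+1 then F *m fluct t' o + xi t' o else 0.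

Lemma noise_L2vec t : L2vec P (xi t).
Proof. by move=> i; exact: noise_Lfun2. Qed.

Lemma cross_noise s t : cross P (xi s) (xi t) = if s == t then W else 0.
Proof.
apply/matrixP => i j; rewrite mxE Er_noise_mul//.
by case: ifP; rewrite // mxE.
Qed.

Lemma fluct_L2vec t : L2vec P (fluct t).
Proof.
elim: t => [|t IH]; first exact: L2vec_cst.
by apply: L2vecD; [exact: L2vecM|exact: noise_L2vec].
Qed.

Lemma mean_fluct t : mean P (fluct t) = 0.
Proof.
elim: t => [|t IH]; first exact: mean_cst.
rewrite meanD; [|exact/L2vecM/fluct_L2vec|exact: noise_L2vec].
rewrite meanM ?IH ?mulmx0 ?add0r; last exact: fluct_L2vec.
by apply/colP => i; rewrite !mxE Er_noise.
Qed.

(** [fluct t] involves only the noise before time [t], which is uncorrelated with [xi s]. *)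
Lemma cross_fluct_noise s t : (t <= s)%N -> cross P (fluct t) (xi s) = 0.
Proof.
elim: t => [_|t IH ts]; first exact: cross0l.
rewrite crossDl; [|exact/L2vecM/fluct_L2vec|exact: noise_L2vec|exact: noise_L2vec].
rewrite crossMl; [|exact: fluct_L2vec|exact: noise_L2vec].
by rewrite IH 1?ltnW// mulmx0 cross_noise (ltn_eqF ts) addr0.
Qed.

Lemma cross_fluct t :
  cross P (fluct t) (fluct t) = \sum_(k < t) F ^+ k *m W *m (F ^+ k)^T.
Proof.
elim: t => [|t IH].
  by rewrite big_ord0 /= cross0l.
have fl := fluct_L2vec; have nl := noise_L2vec; have Fl s := L2vecM F (fl s).
rewrite big_ord_recl expr0 trmx1 mulmx1 mul1mx.
(* The discrete Lyapunov recursion: the mixed terms vanish because the state is uncorrelated with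
   the current noise. *)
transitivity (F *m cross P (fluct t) (fluct t) *m F^T + W).
  rewrite /= crossDl//; last exact: L2vecD.
  rewrite !(crossDr (Fl t) (nl t))// !crossMl// !crossMr// cross_noise eqxx.
  have zx := cross_fluct_noise (leqnn t); have xz := crossT P (fluct t) (xi t).
  rewrite -xz zx.
  by rewrite trmx0 mulmx0 mul0mx addr0 add0r mulmxA.
rewrite IH addrC mulmx_sumr mulmx_suml; congr (_ + _); apply: eq_bigr => k _.
rewrite lift0 exprS [F * _]/(F *m _) trmx_mul.
by rewrite !mulmxA.
Qed.

(** The trace is the expectation of the nonnegative variable [quad M] taken at [Z] times the noise
    at time 0. *)
Lemma mxtrace_cov_ge0 (p : nat) (M : 'M[R]_p) (Z : 'M[R]_(p, n)) :
  (forall x, 0 <= quad M x) -> 0 <= \tr (M *m (Z *m W *m Z^T)).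
Proof.
move=> M0; have nl := noise_L2vec 0; have Zl := L2vecM Z nl.
have := cross_noise 0 0; rewrite eqxx => <-.
rewrite -crossMl// -crossMr// -Er_bilin//; apply: Er_ge0 => o; exact: M0.
Qed.

End Fluctuation.

(** * The Lagrangian of a stabilizing policy *)

(** A nonzero left kernel vector of [1 - F] would be an eigenvector for the eigenvalue 1, forcing
    [1 <= nrm (F^p)]. *)
Lemma unitmx_sub1 (R : realType) n (F : 'M[R]_n) p :
  nrm (F ^+ p) < 1 -> 1%:M - F \in unitmx.
Proof.
move=> Fp; rewrite -row_free_unit; apply: inj_row_free => v.
rewrite mulmxBr mulmx1 => /eqP; rewrite subr_eq0 => /eqP vF.
have vF1 : v *m F = 1 *: v by rewrite -vF scale1r.
apply: contraTeq Fp => v0; rewrite -leNgt.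
by have := eigenvalue_exp_nrm p v0 vF1; rewrite normr1 expr1n.
Qed.

Section QuadraticForms.
Variable R : realType.

Lemma bilinT n p (M : 'M[R]_(n, p)) (x : 'cV[R]_n) (y : 'cV[R]_p) :
  (x^T *m M *m y) 0 0 = (y^T *m M^T *m x) 0 0.
Proof.
have <- : (x^T *m M *m y)^T = y^T *m M^T *m x by rewrite !trmx_mul trmxK mulmxA.
by rewrite [RHS]mxE.
Qed.

Lemma quadD n (M : 'M[R]_n) (x y : 'cV[R]_n) :
  quad M (x + y) = quad M x + quad M y + (x^T *m (M + M^T) *m y) 0 0.
Proof.
have addE (U V : 'M[R]_1) : (U + V) 0 0 = U 0 0 + V 0 0 by rewrite mxE.
rewrite /quad [(x + y)^T]linearD/= !(mulmxDl, mulmxDr) !addE (bilinT M y x).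
by ring.
Qed.

Lemma quad_mul n p (M : 'M[R]_n) (Z : 'M[R]_(n, p)) (x : 'cV[R]_p) :
  quad M (Z *m x) = quad (Z^T *m M *m Z) x.
Proof. by rewrite /quad trmx_mul !mulmxA. Qed.

End QuadraticForms.

(** * Stationary decomposition of the average cost *)

Section ClosedLoop.
Context d (Omega : measurableType d) (R : realType) (P : probability Omega R).
Variables (n m : nat) (A : 'M[R]_n) (B : 'M[R]_(n, m)) (Q : 'M[R]_n) (Ru : 'M[R]_m).
Variables (w : nat -> Omega -> 'cV[R]_n) (x0 : Omega -> 'cV[R]_n) (rhobar mu : R).

Local Notation W := (covmx P (w 0%N)).

Definition closed_loop (X : 'M[R]_(m, n + 1)) : 'M[R]_n := A - B *m gain X.

Definition stage_weight (X : 'M[R]_(m, n + 1)) : 'M[R]_n :=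
  Qmu P w Q mu + (gain X)^T *m Ru *m gain X.

(* The mean of the stationary state distribution. *)
Definition steady_state (X : 'M[R]_(m, n + 1)) : 'cV[R]_n :=
  invmx (1%:M - closed_loop X) *m (B *m offset X + Emx P (w 0%N)).

Definition steady_cost (X : 'M[R]_(m, n + 1)) : R :=
  cost P w Q Ru rhobar mu (steady_state X) (control X (steady_state X)).

(* Expected cost, at the present time, of the noise that entered k steps ago. *)
Definition noise_cost (X : 'M[R]_(m, n + 1)) (k : nat) : R :=
  \tr (stage_weight X *m
    (closed_loop X ^+ k *m W *m (closed_loop X ^+ k)^T)).

(** Under an affine policy the cost is quadratic in the state, so it expands exactly about the
    steady state. The gradient [q] may stay existential: it meets only the mean deviation, which
    tends to 0. *)
Lemma cost_shift X : exists q : 'rV[R]_n, forall x v,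
  x = steady_state X ->
  cost P w Q Ru rhobar mu (x + v) (control X (x + v)) =
  steady_cost X + quad (stage_weight X) v + (q *m v) 0 0.
Proof.
pose xb := steady_state X; pose K := gain X.
pose u := control X xb.
exists (xb^T *m (Qmu P w Q mu + (Qmu P w Q mu)^T) + 2 *: (Smu P w Q mu)^T
        - u^T *m (Ru + Ru^T) *m K) => _ v ->; rewrite -/xb.
have -> : control X (xb + v) = u + - (K *m v).
  by rewrite /u /control mulmxDr opprD addrAC.
rewrite /steady_cost -/xb -/u /cost !quadD /stage_weight -/K.
have -> : quad (Qmu P w Q mu + K^T *m Ru *m K) v =
    quad (Qmu P w Q mu) v + quad Ru (- (K *m v)).
  rewrite {1}/quad mulmxDr mulmxDl mxE; congr (_ + _).
  by rewrite /quad [(- _)^T]linearN/= mulNmx mulNmx mulmxN opprK trmx_mul !mulmxA.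
have -> : dotv (xb + v) (Smu P w Q mu) =
    dotv xb (Smu P w Q mu) + ((Smu P w Q mu)^T *m v) 0 0.
  rewrite /dotv [(_ + _)^T]linearD/= mulmxDl mxE; congr (_ + _).
  by rewrite !mxE; apply: eq_bigr => i _; rewrite !mxE mulrC.
have addE (U V : 'M[R]_1) : (U + V) 0 0 = U 0 0 + V 0 0 by rewrite mxE.
have oppE (U : 'M[R]_1) : (- U) 0 0 = - U 0 0 by rewrite mxE.
have scaleE a (U : 'M[R]_1) : (a *: U) 0 0 = a * U 0 0 by rewrite mxE.
rewrite mulmxN !mulmxDl !mulNmx -scalemxAl !addE !oppE scaleE -!mulmxA.
by ring.
Qed.

Hypothesis w_iid : iid P w.
Hypothesis w_moment : forall t, finite_moment P 4 (w t).
Hypothesis x0_moment : finite_moment P 2 x0.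

Variable X : 'M[R]_(m, n + 1).
Hypothesis X_stab : stabilizing A B X.

Local Notation F := (closed_loop X).
Local Notation xb := (steady_state X).

Let F_geo : exists c r : R, [/\ 0 <= c, 0 < r < 1 & forall k, nrm (F ^+ k) <= c * r ^+ k].
Proof. exact: mxpow_geometric X_stab. Qed.

Lemma mxpow_cvg0 : nrm (F ^+ k) @[k --> \oo] --> 0.
Proof.
have [c [r [c0 /andP[r0 r1] Fk]]] := F_geo.
apply: (@squeeze_cvgr _ _ _ _ (fun=> 0) (fun k => c * r ^+ k)).
- by apply: nearW => k; rewrite nrm_ge0 Fk.
- exact: cvg_cst.
- rewrite -[0](mulr0 c); apply: cvgM; first exact: cvg_cst.
  by apply: cvg_expr; rewrite ger0_norm// ltW.
Qed.

Lemma closed_loop_unit : 1%:M - F \in unitmx.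
Proof.
have /cvgr0Pnorm_lt/(_ 1 ltr01)[N _ /(_ N (leqnn N))] := mxpow_cvg0.
by rewrite ger0_norm ?nrm_ge0//; exact: unitmx_sub1.
Qed.

Let z := fluct P w F.
Let e0 o := x0 o - xb.

(** [xb] is the fixed point of the mean dynamics, so the deviation from it is the response to the
    centred noise plus the initial error carried by [F^t]. *)
Lemma stateE t o : state A B w x0 X t o = xb + (z t o + F ^+ t *m e0 o).
Proof.
elim: t => [|t IH]; first by rewrite /= expr0 mul1mx add0r addrC subrK.
have xbE : xb - F *m xb = B *m offset X + Emx P (w 0%N).
  by rewrite -{1}[xb]mul1mx -mulmxBl mulKVmx// closed_loop_unit.
have step x : A *m x + B *m control X x = F *m x + B *m offset X.
  rewrite /control mulmxDr mulmxN addrA; congr (_ + _).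
  by rewrite mulmxBl mulmxA.
rewrite /= step IH mulmxDr mulmxDr /noise.
rewrite exprS [F * _]/(F *m _) -mulmxA.
have -> : B *m offset X = xb - F *m xb - Emx P (w 0%N) by rewrite xbE addrK.
rewrite -!addrA; set a := F *m xb; set b := F *m _; set c := F *m _.
set e := Emx _ _.
apply/colP => i; rewrite !mxE; ring.
Qed.

Let z_L2 t : L2vec P (z t). Proof. exact: fluct_L2vec. Qed.

Let e0_L2 : L2vec P e0.
Proof. exact: (L2vecD x0_moment (L2vec_cst P (- xb))). Qed.

Let v t o := z t o + F ^+ t *m e0 o.

Let v_L2 t : L2vec P (v t).
Proof. by apply: L2vecD => //; exact: L2vecM. Qed.

Let stage t o := cost P w Q Ru rhobar mu (state A B w x0 X t o)
                      (control X (state A B w x0 X t o)).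

Let stageE : exists q : 'rV[R]_n, forall t,
  stage t = fun o => steady_cost X + (quad (stage_weight X) (v t o) + (q *m v t o) 0 0).
Proof.
have [q qE] := cost_shift X; exists q => t; apply/funext => o.
by rewrite /stage stateE qE// addrA.
Qed.

Let lin_L1 (q : 'rV[R]_n) t : (fun o => (q *m v t o) 0 0) \in Lfun P 1.
Proof. exact/Lfun2_Lfun1/(L2vecM q (v_L2 t)). Qed.

Let stage_L1 t : stage t \in Lfun P 1.
Proof.
have [q ->] := stageE; apply: LfunD => //; first exact: (Lfun_cst P _ 1).
by apply: LfunD => //; exact: bilin_Lfun1.
Qed.

Lemma Er_stage : exists q : 'rV[R]_n, forall t,
  Er P (stage t) = steady_cost X + \tr (stage_weight X *m cross P (v t) (v t))
    + (q *m (F ^+ t *m mean P e0)) 0 0.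
Proof.
have [q qE] := stageE; exists q => t; rewrite qE ErD; first last.
- by apply: LfunD => //; exact: bilin_Lfun1.
- exact: (Lfun_cst P _ 1).
rewrite Er_cst ErD//; last exact: bilin_Lfun1.
rewrite Er_bilin// Er_lin// addrA; congr (_ + (_ *m _) 0 0).
by rewrite meanD ?meanM ?mean_fluct ?add0r//; exact: L2vecM.
Qed.

Lemma noise_cost_sum t :
  \sum_(0 <= k < t) noise_cost X k = \tr (stage_weight X *m cross P (z t) (z t)).
Proof.
by rewrite cross_fluct// mulmx_sumr raddf_sum/= big_mkord.
Qed.

Lemma cross_fluct_bounded : exists D, 0 <= D /\ forall t, nrm (cross P (z t) (z t)) <= D.
Proof.
have [c [r [c0 /andP[r0 r1] Fk]]] := F_geo.
have r1' : 0 < 1 - r by rewrite subr_gt0.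
exists (c * nrm W * c / (1 - r)); split.
  by rewrite divr_ge0 ?(ltW r1')// !mulr_ge0 ?nrm_ge0.
move=> t; rewrite cross_fluct// (le_trans (nrm_sum _ _))//.
apply: (@le_trans _ _ (\sum_(k < t) (c * nrm W * c) * r ^+ k)).
  apply: ler_sum => k _.
  rewrite (le_trans (nrmM _ _))// nrmT.
  (* One factor [F^k] keeps its decay and the other is bounded by [c]; the geometric sum then yields
     the denominator [1 - r]. *)
  have -> : c * nrm W * c * r ^+ k = c * r ^+ k * nrm W * (c * 1) by ring.
  apply: ler_pM; rewrite ?nrm_ge0//; last first.
    by rewrite (le_trans (Fk k))// ler_wpM2l// exprn_ile1 ?(ltW r0) ?(ltW r1).
  by rewrite (le_trans (nrmM _ _))// ler_wpM2r ?nrm_ge0.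
rewrite -mulr_sumr ler_wpM2l ?mulr_ge0 ?nrm_ge0//.
have -> : \sum_(k < t) r ^+ k = (1 - r ^+ t) / (1 - r).
  apply: (mulIf (lt0r_neq0 r1')); rewrite divfK ?gt_eqF//.
  by rewrite mulrC -[1 in RHS](expr1n R t) subrXX; congr (_ * _); apply: eq_bigr => i _;
    rewrite expr1n mul1r.
by rewrite ler_pdivrMr// mulVf ?gt_eqF// gerBl exprn_ge0 ?(ltW r0).
Qed.

(** The initial state is forgotten: each term of the difference carries a factor [F^t] times a
    quantity bounded in [t]. *)
Lemma Er_stage_cvg :
  Er P (stage t) - (steady_cost X + \sum_(0 <= k < t) noise_cost X k) @[t --> \oo] --> 0.
Proof.
have [q qE] := Er_stage.
have [c [r [c0 /andP[r0 r1] Fk]]] := F_geo.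
have [D [D0 zD]] := cross_fluct_bounded.
set M := stage_weight X.
(* [E] bounds the mixed moments of [z t] and [e0] for all [t]; in the term quadratic in [e0], one of
   the two factors [F^t] is bounded by [c]. *)
pose E := (D + nrm (cross P e0 e0)) * (n * n)%:R.
pose C := nrm M * (E + E + nrm (cross P e0 e0) * c) + nrm q * nrm (mean P e0).
have bound t : `|Er P (stage t) - (steady_cost X + \sum_(0 <= k < t) noise_cost X k)|
    <= C * nrm (F ^+ t).
  have -> : Er P (stage t) - (steady_cost X + \sum_(0 <= k < t) noise_cost X k) =
     \tr (M *m (cross P (z t) e0 *m (F ^+ t)^T + F ^+ t *m cross P e0 (z t) +
          F ^+ t *m cross P e0 e0 *m (F ^+ t)^T)) + (q *m (F ^+ t *m mean P e0)) 0 0.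
    rewrite qE noise_cost_sum -/M.
    have zl := z_L2 t; have rl := L2vecM (F ^+ t) e0_L2.
    have -> : cross P (v t) (v t) = cross P (z t) (z t) +
        (cross P (z t) e0 *m (F ^+ t)^T + F ^+ t *m cross P e0 (z t) +
          F ^+ t *m cross P e0 e0 *m (F ^+ t)^T).
      rewrite (crossDl zl rl (v_L2 t)) !(crossDr zl rl)//.
      by rewrite !crossMl// !crossMr// -!addrA; congr (_ + (_ + (_ + _))); rewrite mulmxA.
    by rewrite [M *m (cross P (z t) (z t) + _)]mulmxDr mxtraceD; ring.
  rewrite (le_trans (ler_normD _ _))// /C mulrDl lerD//; last first.
    rewrite (le_trans (le_nrm _ _ _))// (le_trans (nrmM _ _))// -mulrA.
    by rewrite ler_wpM2l ?nrm_ge0// (le_trans (nrmM _ _))// mulrC.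
  rewrite (le_trans (nrm_mxtrace _))// (le_trans (nrmM _ _))// -mulrA.
  rewrite ler_wpM2l ?nrm_ge0// 2!mulrDl.
  have ze : nrm (cross P (z t) e0) <= E.
    by rewrite (le_trans (nrm_cross _ _))// /E ler_wpM2r// lerD2r.
  rewrite (le_trans (nrmD _ _))// lerD//.
    rewrite (le_trans (nrmD _ _))// lerD//.
      by rewrite (le_trans (nrmM _ _))// nrmT ler_wpM2r ?nrm_ge0.
    by rewrite (le_trans (nrmM _ _))// mulrC -(crossT P (z t)) nrmT ler_wpM2r ?nrm_ge0.
  rewrite (le_trans (nrmM _ _))// nrmT ler_wpM2r ?nrm_ge0//.
  rewrite (le_trans (nrmM _ _))// mulrC ler_wpM2l ?nrm_ge0//.
  by rewrite (le_trans (Fk t))// ler_piMr// exprn_ile1 ?(ltW r0) ?(ltW r1).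
apply/cvgr0Pnorm_le => e e0'.
have : (fun t => C * nrm (F ^+ t)) @ \oo --> 0.
  by rewrite -[0](mulr0 C); apply: cvgM; [exact: cvg_cst|exact: mxpow_cvg0].
move=> /cvgr0Pnorm_le/(_ e e0'); apply: filterS => t.
by apply: le_trans; rewrite (le_trans (bound t))// ler_norm.
Qed.

Hypothesis weight_ge0 : forall x, 0 <= quad (stage_weight X) x.

Lemma noise_cost_ge0 k : 0 <= noise_cost X k.
Proof. exact: mxtrace_cov_ge0. Qed.

Lemma noise_cost_cvg : cvgn (fun t => \sum_(0 <= k < t) noise_cost X k).
Proof.
apply: nondecreasing_is_cvgn.
  apply/nondecreasing_seqP => t; rewrite big_nat_recr//= lerDl.
  exact: noise_cost_ge0.
have [D [D0 zD]] := cross_fluct_bounded.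
exists (nrm (stage_weight X) * D) => _ [t _ <-].
rewrite noise_cost_sum (le_trans (ler_norm _))// (le_trans (nrm_mxtrace _))//.
by rewrite (le_trans (nrmM _ _))// ler_wpM2l ?nrm_ge0.
Qed.

Lemma lagrangianE : lagrangian A B P w x0 Q Ru rhobar mu X =
  (steady_cost X + limn (fun t => \sum_(0 <= k < t) noise_cost X k))%:E.
Proof.
set G := limn _.
have Gcvg : \sum_(0 <= k < t) noise_cost X k @[t --> \oo] --> G by exact: noise_cost_cvg.
have stage_cvg : Er P (stage t) @[t --> \oo] --> steady_cost X + G.
  have -> : (fun t => Er P (stage t)) = (fun t =>
      (Er P (stage t) - (steady_cost X + \sum_(0 <= k < t) noise_cost X k)) +
      (steady_cost X + \sum_(0 <= k < t) noise_cost X k)).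
    by apply/funext => t; rewrite subrK.
  rewrite -[X in _ --> X]add0r; apply: cvgD; first exact: Er_stage_cvg.
  by apply: cvgD => //; exact: cvg_cst.
rewrite /lagrangian; apply/cvg_lim => //.
rewrite (_ : (fun T => _) = EFin \o (fun T => T%:R^-1 * \sum_(0 <= t < T) Er P (stage t))).
  apply: cvg_EFin; first by apply: nearW.
  (* The means in [cesaro] start with one term, hence the shift past [T = 0]. *)
  by rewrite -cvg_shiftS; exact: cesaro stage_cvg.
apply/funext => T /=; rewrite EFinM; congr (_ * _)%E.
rewrite -Er_sum// /Er fineK//; apply: expectation_fin_num.
exact: Lfun_sum.
Qed.

(** Trades the limit for conditions on partial sums. Each of them passes to limits of policies, so
    continuity of the Lagrangian itself never has to be proved. *)
Lemma lagrangian_le (alpha : R) :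
  (lagrangian A B P w x0 Q Ru rhobar mu X <= alpha%:E)%E <->
  forall N, steady_cost X + \sum_(0 <= k < N) noise_cost X k <= alpha.
Proof.
rewrite lagrangianE lee_fin; split => [le N|le].
  apply: le_trans le; rewrite lerD2l.
  apply: (@nondecreasing_cvgn_le _ (fun t => \sum_(0 <= k < t) noise_cost X k)).
    apply/nondecreasing_seqP => t; rewrite big_nat_recr//= lerDl.
    exact: noise_cost_ge0.
  exact: noise_cost_cvg.
rewrite -lerBrDl; apply: limr_le; first exact: noise_cost_cvg.
by apply: nearW => N; rewrite lerBrDl.
Qed.

End ClosedLoop.

(** * Entrywise convergence and compactness *)

Section EntrywiseConvergence.
Context (R : realType) (T : Type) (F : set_system T) {FF : Filter F}.

Definition mxcvg p q (f : T -> 'M[R]_(p, q)) (a : 'M[R]_(p, q)) : Prop :=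
  forall i j, f x i j @[x --> F] --> a i j.

Lemma mxcvg_cst p q (a : 'M[R]_(p, q)) : mxcvg (fun=> a) a.
Proof. by move=> i j; exact: cvg_cst. Qed.

Lemma cvg_bigsum (I : Type) (r : seq I) (f : I -> T -> R) (a : I -> R) :
  (forall i, f i @ F --> a i) ->
  \sum_(i <- r) f i x @[x --> F] --> \sum_(i <- r) a i.
Proof. by move=> fa; apply: cvg_big => //; exact: add_continuous. Qed.

Lemma cvg_bigprod (I : Type) (r : seq I) (f : I -> T -> R) (a : I -> R) :
  (forall i, f i @ F --> a i) ->
  \prod_(i <- r) f i x @[x --> F] --> \prod_(i <- r) a i.
Proof. by move=> fa; apply: cvg_big => //; exact: mul_continuous. Qed.

Lemma mxcvgD p q (f g : T -> 'M[R]_(p, q)) a b :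
  mxcvg f a -> mxcvg g b -> mxcvg (fun x => f x + g x) (a + b).
Proof.
move=> fa gb i j; rewrite mxE; under eq_fun do rewrite mxE.
exact: cvgD (fa i j) (gb i j).
Qed.

Lemma mxcvgN p q (f : T -> 'M[R]_(p, q)) a :
  mxcvg f a -> mxcvg (fun x => - f x) (- a).
Proof.
move=> fa i j; rewrite mxE; under eq_fun do rewrite mxE.
exact: cvgN (fa i j).
Qed.

Lemma mxcvgM p q r (f : T -> 'M[R]_(p, q)) (g : T -> 'M[R]_(q, r)) a b :
  mxcvg f a -> mxcvg g b -> mxcvg (fun x => f x *m g x) (a *m b).
Proof.
move=> fa gb i j; rewrite mxE; under eq_fun do rewrite mxE.
by apply: cvg_bigsum => k; exact: cvgM (fa i k) (gb k j).
Qed.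

Lemma mxcvgZ p q (f : T -> R) (g : T -> 'M[R]_(p, q)) (a : R) b :
  f @ F --> a -> mxcvg g b -> mxcvg (fun x => f x *: g x) (a *: b).
Proof.
move=> fa gb i j; rewrite mxE; under eq_fun do rewrite mxE.
exact: cvgM fa (gb i j).
Qed.

Lemma mxcvgT p q (f : T -> 'M[R]_(p, q)) a :
  mxcvg f a -> mxcvg (fun x => (f x)^T) a^T.
Proof. by move=> fa i j; rewrite mxE; under eq_fun do rewrite mxE; exact: fa. Qed.

Lemma mxcvgX p (f : T -> 'M[R]_p) a k :
  mxcvg f a -> mxcvg (fun x => f x ^+ k) (a ^+ k).
Proof.
move=> fa; elim: k => [|k IH].
  by under eq_fun do rewrite expr0; rewrite expr0; exact: mxcvg_cst.
under eq_fun do rewrite exprS.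
by rewrite exprS; exact: mxcvgM.
Qed.

Lemma cvg_mxtrace p (f : T -> 'M[R]_p) a :
  mxcvg f a -> \tr (f x) @[x --> F] --> \tr a.
Proof. by move=> fa; apply: cvg_bigsum => i; exact: fa. Qed.

Lemma cvg_nrm p q (f : T -> 'M[R]_(p, q)) a :
  mxcvg f a -> nrm (f x) @[x --> F] --> nrm a.
Proof.
by move=> fa; do 2!(apply: cvg_bigsum => ?); apply: cvg_norm; exact: fa.
Qed.

Lemma cvg_quad p (M : 'M[R]_p) (f : T -> 'cV[R]_p) a :
  mxcvg f a -> quad M (f x) @[x --> F] --> quad M a.
Proof.
move=> fa; suff : mxcvg (fun x => (f x)^T *m M *m f x) (a^T *m M *m a) by exact.
apply: mxcvgM (fa); apply: mxcvgM; [exact: mxcvgT|exact: mxcvg_cst].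
Qed.

Lemma cvg_det p (f : T -> 'M[R]_p) a :
  mxcvg f a -> \det (f x) @[x --> F] --> \det a.
Proof.
move=> fa; apply: cvg_bigsum => s; apply: cvgM; first exact: cvg_cst.
by apply: cvg_bigprod => i; exact: fa.
Qed.

Lemma mxcvg_adj p (f : T -> 'M[R]_p) a :
  mxcvg f a -> mxcvg (fun x => \adj (f x)) (\adj a).
Proof.
move=> fa i j; rewrite mxE; under eq_fun do rewrite mxE.
rewrite /cofactor; apply: cvgM; first exact: cvg_cst.
apply: cvg_det => k l; rewrite !mxE; under eq_fun do rewrite !mxE.
exact: fa.
Qed.

(** By Cramer's rule the inverse is the adjugate over the determinant. [invmx] returns a singular
    matrix unchanged, so the formula is used only where [f] is invertible. *)
Lemma mxcvg_invmx p (f : T -> 'M[R]_p) a : a \in unitmx ->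
  (\forall x \near F, f x \in unitmx) ->
  mxcvg f a -> mxcvg (fun x => invmx (f x)) (invmx a).
Proof.
move=> ua uf fa i j.
have lim : mxcvg (fun x => (\det (f x))^-1 *: \adj (f x)) (invmx a).
  rewrite /invmx ua; apply: mxcvgZ (mxcvg_adj fa); apply: cvgV (cvg_det fa).
  by rewrite -unitfE -unitmxE.
apply: cvg_trans (lim i j); apply: near_eq_cvg.
by apply: filterS uf => x ux; rewrite /invmx ux.
Qed.

End EntrywiseConvergence.

Lemma mxcvg_id (R : realType) p q (x : 'M[R]_(p, q)) : mxcvg (nbhs x) id x.
Proof. by move=> i j; exact: coord_continuous. Qed.

(** * Compactness in spaces of matrices *)

Section MatrixCompactness.
Variable R : realType.

(** Heine-Borel for row vectors, transported through the continuous map [vec_mx]. *)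
Lemma mx_bounded_closed_compact p q (S : set 'M[R]_(p, q)) (b : R) :
  closed S -> (forall x, S x -> nrm x <= b) -> compact S.
Proof.
move=> Scl Sb.
have vec_cont : continuous (@vec_mx R p q).
  move=> v U /= /nbhs_ballP[e e0 eU]; apply/nbhs_ballP; exists e => // u [_ vu].
  by apply: eU; split => // i j; rewrite !mxE; exact: vu.
have -> : S = vec_mx @` (vec_mx @^-1` S).
  apply/seteqP; split => [x Sx|_ [v /= Sv <-]//].
  by exists (mxvec x); rewrite /= mxvecK.
apply: continuous_compact; first exact: continuous_subspaceT.
apply: bounded_closed_compact; last by apply: preimage_closed.
exists b; split; first exact: num_real.
move=> M bM v /= /Sb vb; rewrite -[leLHS]/(mx_norm _) mx_normrE.
have M0 : 0 <= M by rewrite (le_trans (nrm_ge0 (vec_mx v)))// (le_trans vb)// ltW.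
apply/bigmax_leP; split => // -[i k] _ /=.
rewrite ord1; case/mxvec_indexP: k => k l.
by have := le_nrm (vec_mx v) k l; rewrite mxE => /le_trans; apply; rewrite (le_trans vb)// ltW.
Qed.

Lemma closure_le p q (S : set 'M[R]_(p, q)) (f : 'M[R]_(p, q) -> R) x c :
  closure S x -> f y @[y --> within S (nbhs x)] --> f x ->
  (forall y, S y -> f y <= c) -> f x <= c.
Proof.
move=> Sx fx Sc; rewrite leNgt; apply/negP => cf.
have : \forall y \near within S (nbhs x), c < f y by exact: cvgr_gt fx _ cf.
by move=> /Sx[y [Sy /(_ Sy)]]; rewrite ltNge Sc.
Qed.

(** A Lebesgue-number argument: half of a radius admissible at [x] is admissible at every point
    within that half, and compactness makes the choice uniform. *)
Lemma compact_open_ball p q (K O : set 'M[R]_(p, q)) :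
  compact K -> open O -> K `<=` O ->
  exists2 e : R, 0 < e & forall x, K x -> ball x e `<=` O.
Proof.
move=> /compact_near_coveringP cK oO KO.
have [e /= e0 eK] : \forall e \near 0^'+, K `<=` (fun x => ball x e `<=` O).
  apply: cK => x /KO Ox.
  have /nbhs_ballP[r /= r0 rO] : nbhs x O by exact: open_nbhs_nbhs.
  have r2 : 0 < r / 2 by rewrite divr_gt0.
  exists (ball x (r / 2), [set e | e < r / 2]) => /=.
    by split; [exact: nbhsx_ballx|exact: nbhs_right_lt].
  move=> [y e] /= [xy er] z yz; apply: rO; rewrite [r]splitr.
  by apply: ball_triangle xy _; exact: le_ball (ltW er) _ yz.
exists (e / 2); first by rewrite divr_gt0.
apply: eK => /=; last by rewrite divr_gt0.
by rewrite sub0r normrN gtr0_norm ?divr_gt0// ltr_pdivrMr// ltr_pMr// ltr1n.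
Qed.

End MatrixCompactness.

(** * Lower bounds for positive definite forms *)

Section Definiteness.
Variable R : realType.

Lemma quadZ n (M : 'M[R]_n) a (x : 'cV[R]_n) : quad M (a *: x) = a ^+ 2 * quad M x.
Proof.
rewrite /quad [(a *: x)^T]linearZ/= -!scalemxAl -scalemxAr scalerA mxE.
by rewrite expr2.
Qed.

Lemma quad0 n (M : 'M[R]_n) : quad M 0 = 0.
Proof. by rewrite -(scale0r 0) quadZ expr2 !mul0r. Qed.

Lemma quad_addl n (M N : 'M[R]_n) x : quad (M + N) x = quad M x + quad N x.
Proof. by rewrite /quad mulmxDr mulmxDl mxE. Qed.

Lemma quad_scalel n a (M : 'M[R]_n) x : quad (a *: M) x = a * quad M x.
Proof. by rewrite /quad -scalemxAr -scalemxAl mxE. Qed.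

Lemma quad1 n (x : 'cV[R]_n) : quad 1%:M x = \sum_i x i 0 ^+ 2.
Proof.
by rewrite /quad mulmx1 mxE; apply: eq_bigr => i _; rewrite mxE expr2.
Qed.

(** [c] is the minimum of the form on the compact unit sphere of [nrm]; homogeneity of degree 2 does
    the rest. *)
Lemma posdef_lower_bound n (M : 'M[R]_n) : posdef M ->
  exists2 c : R, 0 < c & forall x, c * nrm x ^+ 2 <= quad M x.
Proof.
move=> [_ M0]; pose S := [set x : 'cV[R]_n | nrm x = 1].
have nrm_cont : continuous (fun x : 'cV[R]_n => nrm x).
  by move=> x; exact: cvg_nrm (@mxcvg_id R n 1 x).
have quad_cont : continuous (fun x : 'cV[R]_n => quad M x).
  by move=> x; exact: cvg_quad (@mxcvg_id R n 1 x).
have cS : compact S.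
  apply: (@mx_bounded_closed_compact _ _ _ _ 1) => [|x ->//].
  rewrite (_ : S = nrm (n:=1) @^-1` [set 1]) //.
  by apply: preimage_closed => //; exact: closed_eq.
have normalize x : x != 0 -> S ((nrm x)^-1 *: x).
  move=> /nrm_gt0 x0; rewrite /S/= nrmZ ger0_norm ?invr_ge0 ?nrm_ge0//.
  by rewrite mulVf// gt_eqF.
have [S0|S0] := pselect (S !=set0); last first.
  (* With an empty unit sphere the only vector is 0, and any constant works. *)
  exists 1 => // x; have [->|x0] := eqVneq x 0.
    by rewrite quad0 nrm0 expr2 !mulr0.
  by case: S0; exists ((nrm x)^-1 *: x); exact: normalize.
have [x1 /set_mem x1S x1min] := compact_EVT_min S0 cS (continuous_subspaceT quad_cont).
exists (quad M x1).
  by apply: M0; apply: contra_eq_neq x1S => ->; rewrite nrm0 eq_sym oner_eq0.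
move=> x; have [->|x0] := eqVneq x 0.
  by rewrite quad0 nrm0 expr2 !mulr0.
have xg0 := nrm_gt0 x0.
have := x1min _ (mem_set (normalize x x0)).
by rewrite quadZ exprVn mulrC ler_pdivlMr ?exprn_gt0.
Qed.

Lemma posdef_entry_bound n (M : 'M[R]_n) : posdef M ->
  exists2 c : R, 0 < c & forall (x : 'cV[R]_n) i, c * x i 0 ^+ 2 <= quad M x.
Proof.
move=> /posdef_lower_bound[c c0 cM]; exists c => // x i.
rewrite (le_trans _ (cM x))// ler_pM2l// -[x i 0 ^+ 2]real_normK ?num_real//.
by rewrite lerXn2r ?nnegrE ?nrm_ge0// le_nrm.
Qed.

End Definiteness.

(** * Consequences of observability *)

Section Observability.
Variable R : realType.
Variables (n p : nat) (A : 'M[R]_n) (N : 'M[R]_(p, n)).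
Hypothesis AN_obs : observable A N.

Lemma observable_left_inverse :
  exists D : 'I_n -> 'M[R]_(n, p), \sum_(i < n) D i *m (N *m A ^+ i) = 1%:M.
Proof.
set O := \mxcol_(i < n) (N *m A ^+ i).
have fullO : row_full O by rewrite /row_full; apply/eqP; exact: AN_obs.
exists (fun i => submxrow (pinvmx O) i).
by rewrite -mul_mxrow_mxcol submxrowK mulVpmx.
Qed.

(** Each [A^i] equals 1 modulo right multiples of [1 - A]; substituting this in the left inverse of
    the observability matrix gives the identity. It recovers the steady state [x] from [N x] and
    [(1 - A) x]. *)
Lemma observable_bezout :
  exists D E, D *m N + E *m (1%:M - A) = 1%:M.
Proof.
have [D DE] := observable_left_inverse.
have powE i : exists G, A ^+ i = 1%:M + G *m (1%:M - A).
  elim: i => [|i [G IH]]; first by exists 0; rewrite mul0mx addr0 expr0.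
  exists (G - A ^+ i); rewrite mulmxBl addrA -IH mulmxBr mulmx1.
  by rewrite exprSr subKr.
have [G GE] := choice powE.
exists (\sum_i D i), (\sum_i D i *m N *m G i).
rewrite -[RHS]DE !mulmx_suml -big_split/=; apply: eq_bigr => i _.
by rewrite [A ^+ i]GE [in RHS]mulmxDr mulmx1 [in RHS]mulmxDr !mulmxA.
Qed.

(** Vanishing output and input force a vanishing state: [N A^(i+1) Y_k = N A^i Y_(k+1) - N A^i B
    U_k] propagates the limit to every [N A^i Y], and the left inverse reassembles [Y]. *)
Lemma observable_cvg0 q r (B : 'M[R]_(n, q)) (Y : nat -> 'M[R]_(n, r))
    (U : nat -> 'M[R]_(q, r)) :
  (forall k, Y k.+1 = A *m Y k + B *m U k) ->
  mxcvg \oo (fun k => N *m Y k) 0 -> mxcvg \oo U 0 -> mxcvg \oo Y 0.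
Proof.
move=> YS NY0 U0.
have NAY i : mxcvg \oo (fun k => N *m A ^+ i *m Y k) 0.
  elim: i => [|i IH]; first by under eq_fun do rewrite expr0 mulmx1.
  have -> : (fun k => N *m A ^+ i.+1 *m Y k) =
      (fun k => N *m A ^+ i *m Y k.+1 + - (N *m A ^+ i *m B *m U k)).
    by apply/funext => k; rewrite YS mulmxDr !mulmxA addrK exprSr [_ * A]/(_ *m A) mulmxA.
  rewrite -[0]subr0; apply: mxcvgD.
    by move=> a b; have := IH a b; rewrite -(cvg_shiftS (fun k => (N *m A ^+ i *m Y k) a b)).
  apply: mxcvgN; rewrite -[0](mulmx0 _ (N *m A ^+ i *m B)).
  by apply: mxcvgM => //; exact: mxcvg_cst.
have [D DE] := observable_left_inverse.
have -> : Y = fun k => \sum_i D i *m (N *m A ^+ i *m Y k).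
  apply/funext => k; rewrite -[LHS]mul1mx -DE mulmx_suml.
  by apply: eq_bigr => i _; rewrite !mulmxA.
move=> a b; rewrite mxE; under eq_fun do rewrite summxE.
suff : \sum_(i < n) (D i *m (N *m A ^+ i *m Y k)) a b @[k --> \oo]
    --> \sum_(i < n) (0 : R) by rewrite [X in _ --> X]big1.
apply: cvg_bigsum => i.
suff : mxcvg \oo (fun k => D i *m (N *m A ^+ i *m Y k)) 0 by move=> /(_ a b); rewrite mxE.
rewrite -[0](mulmx0 _ (D i)).
by apply: mxcvgM => //; exact: mxcvg_cst.
Qed.

End Observability.

(** * Coercivity *)

Section Bounds.
Variable R : realType.

Lemma quad_delta n (x : 'cV[R]_n) i : quad (delta_mx i i) x = x i 0 ^+ 2.
Proof.
rewrite /quad -(mul_delta_mx (0 : 'I_1)) mulmxA -mulmxA -colE -rowE.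
by rewrite mxE big_ord1 !mxE expr2.
Qed.

Lemma mxtrace_delta n (S : 'M[R]_n) i : \tr (delta_mx i i *m S) = S i i.
Proof.
rewrite -(mul_delta_mx (0 : 'I_1)) -mulmxA mxtrace_mulC -rowE -colE.
by rewrite /mxtrace big_ord1 !mxE.
Qed.

Lemma mxtrace_conj n p q (M : 'M[R]_p) (Z : 'M[R]_(p, n)) (Y : 'M[R]_(n, q)) (V : 'M[R]_q) :
  \tr (Z^T *m M *m Z *m (Y *m V *m Y^T)) =
  \tr (M *m ((Z *m Y) *m V *m (Z *m Y)^T)).
Proof.
by rewrite -!mulmxA mxtrace_mulC trmx_mul !mulmxA.
Qed.

Lemma nrm_le_sqr p q (M : 'M[R]_(p, q)) (c b : R) : 0 < c ->
  (forall i j, c * M i j ^+ 2 <= b) -> nrm M <= (p * q)%:R * (1 + b / c).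
Proof.
move=> c0 Mb.
(* The inequality [t <= 1 + t^2] replaces a square root. *)
have le i j : `|M i j| <= 1 + b / c.
  have := Mb i j; rewrite mulrC -ler_pdivlMr// -real_normK ?num_real// => sq.
  have := normr_ge0 (M i j); set a := `|_| in sq *; set bc := b / c in sq *.
  by move=> a0; nra.
rewrite /nrm (le_trans (ler_sum _ (fun i _ => ler_sum _ (fun j _ => le i j))))//.
by rewrite !sumr_const !card_ord -mulrnA mulr_natl mulnC.
Qed.

Lemma nrm_row_mx p q1 q2 (M1 : 'M[R]_(p, q1)) (M2 : 'M[R]_(p, q2)) :
  nrm (row_mx M1 M2) = nrm M1 + nrm M2.
Proof.
rewrite /nrm -big_split/=; apply: eq_bigr => i _; rewrite big_split_ord/=.
by congr (_ + _); apply: eq_bigr => j _; rewrite (row_mxEl, row_mxEr).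
Qed.

Lemma cvg0_of_sqr (u v : nat -> R) (c : R) : 0 < c ->
  (forall k, c * u k ^+ 2 <= v k) -> v @ \oo --> 0 -> u @ \oo --> 0.
Proof.
move=> c0 uv v0; apply/cvgr0Pnorm_lt => e e0.
have ce : 0 < c * e ^+ 2 by rewrite mulr_gt0// exprn_gt0.
move/cvgr0Pnorm_lt : v0 => /(_ _ ce); apply: filterS => k vk.
have : c * u k ^+ 2 < c * e ^+ 2 by rewrite (le_lt_trans (uv k))// (le_lt_trans (ler_norm _)).
by rewrite ltr_pM2l// -[u k ^+ 2]real_normK ?num_real// ltr_pXn2r ?nnegrE ?(ltW e0).
Qed.

End Bounds.

Section Coercivity.
Context d (Omega : measurableType d) (R : realType) (P : probability Omega R).
Variables (n m : nat) (A : 'M[R]_n) (B : 'M[R]_(n, m)) (Q N : 'M[R]_n) (Ru : 'M[R]_m).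
Variables (w : nat -> Omega -> 'cV[R]_n) (x0 : Omega -> 'cV[R]_n) (rhobar mu : R).
Hypothesis w_iid : iid P w.
Hypothesis w_moment : forall t, finite_moment P 4 (w t).
Hypothesis x0_moment : finite_moment P 2 x0.
Hypothesis W_pos : posdef (covmx P (w 0%N)).
Hypothesis Q_psd : psd Q.
Hypothesis R_pos : posdef Ru.
Hypothesis N_sqrt : is_psd_sqrt Q N.
Hypothesis AN_obs : observable A N.
Hypothesis mu_gt0 : 0 < mu.

Local Notation W := (covmx P (w 0%N)).
Local Notation policy := 'M[R]_(m, n + 1).
Local Notation F := (closed_loop A B).
Local Notation weight := (stage_weight P Q Ru w mu).
Local Notation xbar := (steady_state P A B w).
Local Notation g := (noise_cost P A B Q Ru w mu).
Local Notation h := (steady_cost P A B Q Ru w rhobar mu).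
Local Notation S := (stabilizing A B).

Let Nt : N^T = N. Proof. by case: N_sqrt => -[]. Qed.
Let NN : N *m N = Q. Proof. by case: N_sqrt. Qed.
Let Qt : Q^T = Q. Proof. by case: Q_psd. Qed.

Let W_ge0 x : 0 <= quad W x.
Proof.
have [->|x0'] := eqVneq x 0; first by rewrite quad0.
by apply: ltW; case: W_pos => _; apply.
Qed.

Let R_ge0 x : 0 <= quad Ru x.
Proof.
have [->|x0'] := eqVneq x 0; first by rewrite quad0.
by apply: ltW; case: R_pos => _; apply.
Qed.

Let QWQ_quad x : quad (Q *m W *m Q) x = quad W (Q *m x).
Proof. by rewrite quad_mul Qt. Qed.

Let Q_quad x : quad Q x = \sum_i (N *m x) i 0 ^+ 2.
Proof. by rewrite -quad1 quad_mul Nt mulmx1 NN. Qed.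

Lemma stage_weight_ge0 (X : policy) x : 0 <= quad (weight X) x.
Proof.
rewrite /stage_weight /Qmu !quad_addl quad_scalel -quad_mul QWQ_quad Q_quad.
rewrite !addr_ge0 ?mulr_ge0 ?(ltW mu_gt0)//.
by apply: sumr_ge0 => i _; exact: sqr_ge0.
Qed.

Let g_ge0 (X : policy) k : 0 <= g X k.
Proof. by apply: (noise_cost_ge0 A B w_iid w_moment) => x; exact: stage_weight_ge0. Qed.

(** [M] minus [c] times the [i]-th diagonal unit is still nonnegative, so the trace is at least [c]
    times the [i]-th diagonal entry of [Z W Z^T], which is the form [W] at row [i] of [Z]. *)
Lemma mxtrace_cov_lower_bound p (M : 'M[R]_p) (Z : 'M[R]_(p, n)) (c cW : R) i j :
  0 <= c -> (forall (x : 'cV_p) i, c * x i 0 ^+ 2 <= quad M x) ->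
  (forall (x : 'cV_n) i, cW * x i 0 ^+ 2 <= quad W x) ->
  c * cW * Z i j ^+ 2 <= \tr (M *m (Z *m W *m Z^T)).
Proof.
move=> c0 cM cWW.
have : 0 <= \tr ((M + - c *: delta_mx i i) *m (Z *m W *m Z^T)).
  apply: (mxtrace_cov_ge0 w_iid w_moment) => x.
  by rewrite quad_addl quad_scalel quad_delta mulNr subr_ge0.
rewrite mulmxDl mxtraceD -scalemxAl mxtraceZ mxtrace_delta mulNr subr_ge0.
apply: le_trans; rewrite -mulrA ler_wpM2l//.
have -> : (Z *m W *m Z^T) i i = quad W (row i Z)^T.
  rewrite /quad trmxK -row_mul mxE [RHS]mxE; apply: eq_bigr => k _.
  by rewrite [row _ _ _ _]mxE 2![_^T _ _]mxE [row _ _ _ _]mxE.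
by rewrite (le_trans _ (cWW _ j))// !mxE.
Qed.

Lemma noise_cost_lower_bound : exists2 c : R, 0 < c &
  forall (X : policy) k, (forall i j, c * (N *m F X ^+ k) i j ^+ 2 <= g X k) /\
    (forall i j, c * (gain X *m F X ^+ k) i j ^+ 2 <= g X k).
Proof.
have [cW cW0 cWW] := posdef_entry_bound W_pos.
have [cR cR0 cRR] := posdef_entry_bound R_pos.
(* A constant valid both for the identity form, which handles [Q = N^T N], and for [Ru]. *)
pose c1 : R := Num.min 1 cR.
have c10 : 0 < c1 by rewrite lt_min ltr01.
exists (c1 * cW); first exact: mulr_gt0.
move=> X k; set Y := F X ^+ k; pose V := Y *m W *m Y^T.
have sq_ge0 p (x : 'cV[R]_p) i : x i 0 ^+ 2 <= \sum_i x i 0 ^+ 2.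
  by rewrite (bigD1 i)//= lerDl sumr_ge0// => k' _; exact: sqr_ge0.
have tN i j : c1 * cW * (N *m Y) i j ^+ 2 <= \tr (Q *m V).
  have -> : Q = N^T *m 1%:M *m N by rewrite mulmx1 Nt NN.
  rewrite mxtrace_conj; apply: mxtrace_cov_lower_bound => //; first exact: ltW.
  move=> x i'; rewrite quad1 (le_trans _ (sq_ge0 _ x i'))//.
  by rewrite ler_piMl ?sqr_ge0// ge_min lexx.
have tK i j : c1 * cW * (gain X *m Y) i j ^+ 2 <= \tr ((gain X)^T *m Ru *m gain X *m V).
  rewrite mxtrace_conj; apply: mxtrace_cov_lower_bound => //; first exact: ltW.
  by move=> x i'; rewrite (le_trans _ (cRR x i'))// ler_wpM2r ?sqr_ge0// ge_min lexx orbT.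
have tQ0 : 0 <= \tr (Q *m V).
  by apply: (mxtrace_cov_ge0 w_iid w_moment) => x; case: Q_psd.
have tK0 : 0 <= \tr ((gain X)^T *m Ru *m gain X *m V).
  by apply: (mxtrace_cov_ge0 w_iid w_moment) => x; rewrite -quad_mul.
have tW0 : 0 <= (4 * mu) * \tr (Q *m W *m Q *m V).
  rewrite mulr_ge0 ?mulr_ge0 ?(ltW mu_gt0)//.
  by apply: (mxtrace_cov_ge0 w_iid w_moment) => x; rewrite QWQ_quad.
have gE : g X k = \tr (Q *m V) + (4 * mu) * \tr (Q *m W *m Q *m V)
    + \tr ((gain X)^T *m Ru *m gain X *m V).
  by rewrite /noise_cost /stage_weight /Qmu !mulmxDl !mxtraceD -scalemxAl mxtraceZ.
split=> i j; rewrite gE.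
  by rewrite (le_trans (tN i j))// -addrA lerDl addr_ge0.
by rewrite (le_trans (tK i j))// lerDr addr_ge0.
Qed.

Lemma cost_lower_bound : exists C : R, forall x u,
  2^-1 * (\sum_i (N *m x) i 0 ^+ 2) + quad Ru u - C <=
  cost P w Q Ru rhobar mu x u.
Proof.
pose t := third_moment P (w 0%N) Q; pose s := N *m t.
exists (8 * mu ^+ 2 * (\sum_i s i 0 ^+ 2) + mu * rhobar) => x u.
rewrite /cost /Qmu quad_addl quad_scalel QWQ_quad.
have SE : dotv x (Smu P w Q mu) = 2 * mu * \sum_i (N *m x) i 0 * s i 0.
  rewrite /dotv /Smu -scalemxAr mxE -/t; congr (_ * _).
  have -> : x^T *m (Q *m t) = (N *m x)^T *m s by rewrite /s trmx_mul Nt -NN !mulmxA.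
  rewrite mxE.
  by apply: eq_bigr => i _; rewrite mxE.
rewrite SE Q_quad.
have : 0 <= 4 * mu * quad W (Q *m x) by rewrite mulr_ge0 ?mulr_ge0 ?(ltW mu_gt0).
have : 2^-1 * (\sum_i (N *m x) i 0 ^+ 2) - 8 * mu ^+ 2 * (\sum_i s i 0 ^+ 2) <=
    \sum_i (N *m x) i 0 ^+ 2 + 4 * mu * (\sum_i (N *m x) i 0 * s i 0).
  rewrite !mulr_sumr -sumrN -!big_split/=; apply: ler_sum => i _.
  set a := (N *m x) i 0; set b := s i 0.
  have := sqr_ge0 (a + 4 * mu * b); rewrite !expr2; nra.
(* The sum inequality above is [(a + 4 mu b)^2 / 2 >= 0] in each coordinate: half of [|N x|^2]
   absorbs the linear term. What remains is arithmetic in the abstracted sums. *)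
set q1 := \sum_i _ ^+ 2; set q2 := \sum_i _ ^+ 2; set q3 := \sum_i _ * _.
set q4 := quad W _; set q5 := quad Ru _.
rewrite expr2; nra.
Qed.

(** The sublevel set of the Lagrangian in limit-free form. *)
Definition cost_level (alpha : R) (X : policy) : Prop :=
  S X /\ forall T, h X + \sum_(0 <= k < T) g X k <= alpha.

(** The fixed-point equation in open-loop form, so that bounds on the steady control bound
    [(1 - A) x]. *)
Lemma steady_state_eq (X : policy) : S X ->
  (1%:M - A) *m xbar X = B *m control X (xbar X) + Emx P (w 0%N).
Proof.
move=> SX; have eq : (1%:M - F X) *m xbar X = B *m offset X + Emx P (w 0%N).
  by rewrite mulKVmx// closed_loop_unit.
have FE : 1%:M - F X = 1%:M - A + B *m gain X.
  by rewrite /closed_loop opprB addrA addrAC.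
move: eq; rewrite FE mulmxDl => /(canRL (addrK _)) ->.
by rewrite /control mulmxDr mulmxN -mulmxA addrAC [- _ + _]addrC.
Qed.

Lemma cost_level_bounded alpha : exists b, forall X, cost_level alpha X ->
  nrm X <= b /\ forall T, \sum_(0 <= k < T) g X k <= b.
Proof.
have [c c0 cg] := noise_cost_lower_bound.
have [cR cR0 cRR] := posdef_entry_bound R_pos.
have [C hC] := cost_lower_bound.
have [D [E DE]] := observable_bezout AN_obs.
(* Each nonnegative term of the lower bound is at most [a]. The bounds then come in order: gain,
   control, output, steady state through the Bezout identity, and finally the offset [u + K x]. *)
pose a := alpha + C.
pose bK := (m * n)%:R * (1 + a / c).
pose bu := (m * 1)%:R * (1 + a / cR).
pose bN := (n * 1)%:R * (1 + a / 2^-1).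
pose bx := nrm D * bN + nrm E * (nrm B * bu + nrm (Emx P (w 0%N))).
pose b := bK + (bu + bK * bx).
exists (Num.max b a) => X [SX le].
have sum0 T : 0 <= \sum_(0 <= k < T) g X k by apply: sumr_ge0 => k _.
set x := xbar X; set u := control X x.
have hx := hC x u.
have hle T : 2^-1 * (\sum_i (N *m x) i 0 ^+ 2) + quad Ru u
    + \sum_(0 <= k < T) g X k <= a.
  have := le T; rewrite /steady_cost -/x -/u /a => leT; lra.
have Nx0 : 0 <= \sum_i (N *m x) i 0 ^+ 2 by apply: sumr_ge0 => i _; exact: sqr_ge0.
have u0 := R_ge0 u.
split; last first.
  by move=> T; rewrite le_max; apply/orP; right; have := hle T; lra.
(* At [k = 0] the power of the closed loop is the identity, so the first noise cost alone bounds the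
   gain. *)
have nK : nrm (gain X) <= bK.
  apply: nrm_le_sqr => // i j; have := (cg X 0%N).2 i j; rewrite expr0 mulmx1.
  by move=> /le_trans; apply; have := hle 1%N; rewrite big_nat1; lra.
have nu : nrm u <= bu.
  apply: nrm_le_sqr => // i j; rewrite ord1 (le_trans (cRR u i))//.
  by have := hle 0%N; rewrite big_geq//; lra.
have ny : nrm (N *m x) <= bN.
  apply: nrm_le_sqr; first by rewrite invr_gt0.
  move=> i j; rewrite ord1.
  have : (N *m x) i 0 ^+ 2 <= \sum_i (N *m x) i 0 ^+ 2.
    by rewrite [leRHS](bigD1 i)//= lerDl sumr_ge0// => k' _; exact: sqr_ge0.
  by have := hle 0%N; rewrite big_geq//; lra.
have nx : nrm x <= bx.
  rewrite -[x]mul1mx -DE mulmxDl -!mulmxA (steady_state_eq SX) -/x -/u.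
  rewrite (le_trans (nrmD _ _))// lerD//.
    by rewrite (le_trans (nrmM _ _))// ler_wpM2l ?nrm_ge0.
  rewrite (le_trans (nrmM _ _))// ler_wpM2l ?nrm_ge0//.
  rewrite (le_trans (nrmD _ _))// lerD2r.
  by rewrite (le_trans (nrmM _ _))// ler_wpM2l ?nrm_ge0.
have lE : offset X = u + gain X *m x by rewrite /u /control addrAC addNr add0r.
rewrite le_max -[X]hsubmxK nrm_row_mx -/(gain X) -/(offset X) lE; apply/orP; left.
rewrite lerD// (le_trans (nrmD _ _))// lerD// (le_trans (nrmM _ _))//.
by rewrite ler_pM ?nrm_ge0.
Qed.

Section PolicyLimits.
Context (T : Type) (Fl : set_system T) {FlF : Filter Fl}.
Variables (f : T -> policy) (X : policy).
Hypothesis fX : mxcvg Fl f X.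

Lemma mxcvg_gain : mxcvg Fl (fun t => gain (f t)) (gain X).
Proof. by move=> i j; rewrite mxE; under eq_fun do rewrite mxE; exact: fX. Qed.

Lemma mxcvg_offset : mxcvg Fl (fun t => offset (f t)) (offset X).
Proof. by move=> i j; rewrite mxE; under eq_fun do rewrite mxE; exact: fX. Qed.

Lemma mxcvg_closed_loop : mxcvg Fl (fun t => F (f t)) (F X).
Proof.
apply: mxcvgD; first exact: mxcvg_cst.
by apply: mxcvgN; apply: mxcvgM; [exact: mxcvg_cst|exact: mxcvg_gain].
Qed.

(** The noise cost is polynomial in the policy, hence continuous even at policies not yet known to
    be stabilizing. *)
Lemma cvg_noise_cost k : g (f t) k @[t --> Fl] --> g X k.
Proof.
have FX : mxcvg Fl (fun t => F (f t) ^+ k) (F X ^+ k).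
  by apply: mxcvgX; exact: mxcvg_closed_loop.
apply: cvg_mxtrace; apply: mxcvgM.
  apply: mxcvgD; first exact: mxcvg_cst.
  apply: mxcvgM; last exact: mxcvg_gain.
  by apply: mxcvgM; [apply: mxcvgT; exact: mxcvg_gain|exact: mxcvg_cst].
apply: mxcvgM; last exact: mxcvgT.
by apply: mxcvgM; [exact: FX|exact: mxcvg_cst].
Qed.

(** The steady state involves the inverse of [1 - F], which exists at stabilizing policies; hence
    the two stability conditions. *)
Lemma cvg_steady_cost : S X -> (\forall t \near Fl, S (f t)) ->
  h (f t) @[t --> Fl] --> h X.
Proof.
move=> SX Sf.
have xX : mxcvg Fl (fun t => xbar (f t)) (xbar X).
  apply: mxcvgM.
    apply: mxcvg_invmx; first exact: closed_loop_unit.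
      by apply: filterS Sf => t; exact: closed_loop_unit.
    apply: mxcvgD; first exact: mxcvg_cst.
    by apply: mxcvgN; exact: mxcvg_closed_loop.
  apply: mxcvgD; last exact: mxcvg_cst.
  by apply: mxcvgM; [exact: mxcvg_cst|exact: mxcvg_offset].
have uX : mxcvg Fl (fun t => control (f t) (xbar (f t))) (control X (xbar X)).
  apply: mxcvgD; last exact: mxcvg_offset.
  by apply: mxcvgN; apply: mxcvgM => //; exact: mxcvg_gain.
apply: cvgB; last exact: cvg_cst.
apply: cvgD; last exact: cvg_quad.
apply: cvgD; first exact: cvg_quad.
apply: cvgM; first exact: cvg_cst.
suff : mxcvg Fl (fun t => (xbar (f t))^T *m Smu P w Q mu)
    ((xbar X)^T *m Smu P w Q mu) by exact.
by apply: mxcvgM; [exact: mxcvgT|exact: mxcvg_cst].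
Qed.

End PolicyLimits.

Lemma mxpow_cvg0_stabilizing (X : policy) : mxcvg \oo (fun k => F X ^+ k) 0 -> S X.
Proof.
move=> FX0; have : nrm (F X ^+ k) @[k --> \oo] --> nrm (0 : 'M[R]_n) by exact: cvg_nrm.
(* The index [K.+1] ensures a positive exponent, as [spectral_radius_lt1] requires. *)
rewrite nrm0 => /cvgr0Pnorm_le/(_ 2^-1)[|K _ /(_ K.+1 (leqnSn K))]; first by rewrite invr_gt0.
by rewrite ger0_norm ?nrm_ge0// => /spectral_radius_lt1; apply.
Qed.

(** Smallness of one fixed power of the closed loop is an open condition in the policy and already
    implies stability. *)
Lemma stabilizing_open : open S.
Proof.
rewrite openE => X SX; rewrite /interior.
have [K _ /(_ K.+1 (leqnSn K))] : \forall k \near \oo, `|nrm (F X ^+ k)| < 2^-1.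
  by have /cvgr0Pnorm_lt/(_ 2^-1) := mxpow_cvg0 SX; apply; rewrite invr_gt0.
rewrite ger0_norm ?nrm_ge0// => FK.
have cont : nrm (F Y ^+ K.+1) @[Y --> nbhs X] --> nrm (F X ^+ K.+1).
  by apply: cvg_nrm; apply: mxcvgX; apply: mxcvg_closed_loop; exact: mxcvg_id.
have : \forall Y \near X, nrm (F Y ^+ K.+1) < 2^-1 by exact: cvgr_lt cont _ FK.
by apply: filterS => Y /ltW; exact: spectral_radius_lt1.
Qed.

(* Bounded partial sums force the noise costs, hence Q^(1/2) F^k and K F^k, to
   vanish; observability then gives F^k -> 0. *)
Lemma noise_cost_bounded_stabilizing (X : policy) (b : R) :
  (forall t, \sum_(0 <= k < t) g X k <= b) -> S X.
Proof.
move=> gb; have [c c0 cg] := noise_cost_lower_bound.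
have g0 : g X k @[k --> \oo] --> 0.
  apply: cvg_series_cvg_0; apply: nondecreasing_is_cvgn.
    apply/nondecreasing_seqP => t; rewrite /series/= big_nat_recr//= lerDl.
    exact: g_ge0.
  by exists b => _ [t _ <-]; exact: gb.
apply: mxpow_cvg0_stabilizing.
(* The closed-loop powers are read as an open-loop trajectory of [A], with input matrix [-B] and
   input [K F^k]. *)
apply: (observable_cvg0 AN_obs (B := - B) (U := fun k => gain X *m F X ^+ k)).
- move=> k; have -> : F X ^+ k.+1 = (A - B *m gain X) *m F X ^+ k by rewrite exprS.
  by rewrite mulmxBl mulNmx mulmxA.
- move=> i j; rewrite mxE; apply: (cvg0_of_sqr c0) g0 => k.
  exact: (cg X k).1.
- move=> i j; rewrite mxE; apply: (cvg0_of_sqr c0) g0 => k.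
  exact: (cg X k).2.
Qed.

(** The order matters: the uniform bound on noise costs first passes to the limit and makes it
    stabilizing; only then is the steady cost continuous there. *)
Lemma cost_level_closed alpha : closed (cost_level alpha).
Proof.
have [b lb] := cost_level_bounded alpha.
move=> X clX.
pose Fl := within (cost_level alpha) (nbhs X).
have idX : mxcvg Fl id X.
  by move=> i j; apply: cvg_within_filter; exact: mxcvg_id.
have SX : S X.
  apply: (@noise_cost_bounded_stabilizing _ b) => t.
  apply: (@closure_le _ _ _ _ (fun Y => \sum_(0 <= k < t) g Y k) _ _ clX) => [|Y /lb[]//].
  by apply: cvg_bigsum => k; exact: cvg_noise_cost.
split => // t; apply: (@closure_le _ _ _ _ (fun Y => h Y + \sum_(0 <= k < t) g Y k) _ _ clX).
  apply: cvgD; last by apply: cvg_bigsum => k; exact: cvg_noise_cost.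
  by apply: cvg_steady_cost => //; apply: (@nearW _ (nbhs X)) => Y [].
by move=> Y [_].
Qed.

Lemma cost_level_compact alpha : compact (cost_level alpha).
Proof.
have [b lb] := cost_level_bounded alpha.
by apply: (@mx_bounded_closed_compact _ _ _ _ b) => [|X /lb[]//]; exact: cost_level_closed.
Qed.

Lemma lagrangian_cost_level alpha :
  [set X | S X /\ (lagrangian A B P w x0 Q Ru rhobar mu X <= alpha%:E)%E] = cost_level alpha.
Proof.
by apply/seteqP; split => X [SX LX]; split => //; move: LX;
  rewrite (lagrangian_le _ w_iid w_moment x0_moment SX)//; exact: stage_weight_ge0.
Qed.

End Coercivity.

(** * Blow-up at the boundary from compact sublevel sets *)

Unset Implicit Arguments.

Theorem lemma3 (R : realType) (d : measure_display) (Omega : measurableType d)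
  (P : probability Omega R) (n m : nat)
  (A : 'M[R]_n) (B : 'M[R]_(n, m)) (Q Qhalf : 'M[R]_n) (Ru : 'M[R]_m)
  (w : nat -> Omega -> 'cV[R]_n) (x0 : Omega -> 'cV[R]_n) (rhobar mu : R)
  (w_iid : iid P w)
  (w_moment : forall t, finite_moment P 4 (w t))
  (x0_moment : finite_moment P 2 x0)
  (W_pos : posdef (covmx P (w 0%N)))
  (Q_psd : psd Q) (R_pos : posdef Ru)
  (Qhalf_sqrt : is_psd_sqrt Q Qhalf)
  (AB_ctrl : controllable A B) (AQ_obs : observable A Qhalf)
  (mu_gt0 : 0 < mu) :
  let S := stabilizing A B in
  let L := lagrangian A B P w x0 Q Ru rhobar mu in
  (L X @[X --> to_boundary S] --> +oo%E) /\
  (forall alpha : R, compact [set X | S X /\ (L X <= alpha%:E)%E]).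
Proof.
move=> S L.
have cpt alpha : compact [set X | S X /\ (L X <= alpha%:E)%E].
  rewrite (lagrangian_cost_level A B rhobar w_iid w_moment x0_moment
    W_pos Q_psd R_pos Qhalf_sqrt mu_gt0).
  exact: (cost_level_compact w_iid w_moment W_pos Q_psd R_pos Qhalf_sqrt AQ_obs mu_gt0).
have S_open : open S by exact: stabilizing_open.
split => // U [M [_ MU]].
(* The compact sublevel set at height [M] has a uniform margin [e] inside the open set [S]; this [e]
   is the witness for the boundary filter. *)
have [|e e0 eS] := compact_open_ball (cpt M) S_open; first by move=> X [].
exists e; first exact: e0.
move=> X Y SX [_ nSY] YX.
apply: MU.
(* Otherwise the ball of radius [e] about [X] lies in [S] and contains the boundary point [Y], which
   would then be interior since [S] is open. *)
rewrite ltNge; apply/negP => LX.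
move: S_open; rewrite openE => /(_ Y) SO; apply/nSY/SO.
have XY : ball X e Y by exact: ball_sym.
by apply: (eS X) XY; split.
Qed.
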